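(* Given a map $f\colon\mathbb L(V)\to\mathfrak g$ of simply connected dg Lie algebras, with $\mathbb L(V)$ quasi-free, there exists a minimal relative model for $f$; that is, there exist a minimal relative dg Lie algebra $\mathbb L(V\oplus W)$ with base $\mathbb L(V)$ and a quasi-isomorphism of dg Lie algebras $q\colon\mathbb L(V\oplus W)\to\mathfrak g$ such that $f=q\circ\iota$, where $\iota\colon\mathbb L(V)\to\mathbb L(V\oplus W)$ is the canonical inclusion.
   Context: All dg Lie algebras are over $\mathbb Q$ and homologically graded. $\mathbb L(V)$ denotes a quasi-free dg Lie algebra $(\mathbb L(V),d)$, i.e. one whose underlying graded Lie algebra is free on the graded vector space $V$. A dg Lie algebra $\mathfrak g$ is simply connected if $\mathfrak g=\mathfrak g_{\ge1}$. A KS-extension of a quasi-free dg Lie algebra $\mathbb L(V)$ is a quasi-free dg Lie algebra $\mathbb L(V\oplus U)$ that contains $\mathbb L(V)$ as a dg Lie subalgebra and in which $d(U)\subset Z_*(\mathbb L(V))$, where $Z_*(\mathbb L(V))$ denotes the cycles of $\mathbb L(V)$. A relative dg Lie algebra with base $\mathbb L(V)$ is a colimit $\mathcal M=\bigcup_{n\ge0}\mathcal M[n]$ of a sequence $\mathcal M[0]=\mathbb L(V)\to\mathcal M[1]=\mathbb L(V\oplus W^1)\to\mathcal M[2]=\mathbb L(V\oplus W^1\oplus W^2)\to\cdots$ of KS-extensions starting from $\mathbb L(V)$; thus $\mathcal M=\mathbb L(V\oplus W)$ with $W=\bigoplus_{i\ge1}W^i$. Let $\pi_W\colon\mathbb L(V\oplus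 W)\to W$ be the canonical projection. A relative dg Lie algebra $\mathbb L(V\oplus W)$ with base $\mathbb L(V)$ is called minimal if $\pi_W\circ d(W)=0$. *)

(* Defs.v *)
From mathcomp Require Import all_boot all_order all_algebra.
From mathcomp Require Import boolp classical_sets functions.

Set Implicit Arguments.
Unset Strict Implicit.
Unset Printing Implicit Defensive.

Import Order.TTheory GRing.Theory Num.Theory.
Local Open Scope classical_set_scope.
Local Open Scope ring_scope.

(* Graded vector spaces are presented internally: a rational vector space
   together with a family of subspaces (the homogeneous components) of which
   it is the direct sum.  Generating graded vector spaces of free Lie algebras
   are graded subspaces of the Lie algebra. *)

Definition subspace (M : lmodType rat) (E : set M) : Prop :=
  E 0 /\ forall (a : rat) (x y : M), E x -> E y -> E (a *: x + y).

Definition is_direct_sum (I : eqType) (M : lmodType rat)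
    (S : set M) (E : I -> set M) : Prop :=
  [/\ forall i, subspace (E i),
      forall x, S x <->
        exists s (c : I -> M), (forall i, E i (c i)) /\ x = \sum_(i <- s) c i
    & forall s (c : I -> M), uniq s -> (forall i, E i (c i)) ->
        \sum_(i <- s) c i = 0 -> forall i, i \in s -> c i = 0].

Definition sumset (M : lmodType rat) (A B : set M) : set M :=
  [set x | exists a b, [/\ A a, B b & x = a + b]].

Record gradedSpace := GradedSpace {
  gr_sort :> lmodType rat;
  hcomp : int -> set gr_sort;
  comp_direct : is_direct_sum setT hcomp }.

Definition graded_subspace (M : gradedSpace) (E : set M) : Prop :=
  is_direct_sum E (fun n => E `&` hcomp n).

(* Over the rationals, [x, x] = 0 for x even and [x, [x, x]] = 0 for x odd
   follow from antisymmetry and the Jacobi identity. *)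
Record grLie := GrLie {
  grLie_sort :> gradedSpace;
  br : {bilinear grLie_sort -> grLie_sort -> grLie_sort};
  br_comp : forall i j (x y : grLie_sort),
    hcomp i x -> hcomp j y -> hcomp (i + j) (br x y);
  br_antisym : forall i j (x y : grLie_sort), hcomp i x -> hcomp j y ->
    br x y = - ((-1) ^ (i * j) *: br y x);
  br_jacobi : forall i j (x y z : grLie_sort), hcomp i x -> hcomp j y ->
    br x (br y z) = br (br x y) z + (-1) ^ (i * j) *: br y (br x z) }.
Arguments br {g}.

Record dgLie := DGLie {
  dgLie_sort :> grLie;
  diff : {linear dgLie_sort -> dgLie_sort};
  diff_comp : forall n x, hcomp n x -> hcomp (n - 1) (diff x);
  diffK : forall x, diff (diff x) = 0;
  diff_br : forall i (x y : dgLie_sort), hcomp i x ->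
    diff (br x y) = br (diff x) y + (-1) ^ i *: br x (diff y) }.
Arguments diff {d}.

Record grLieHom (L L' : grLie) := GrLieHom {
  grLieHom_fun :> {linear L -> L'};
  grLieHom_comp : forall n x, hcomp n x -> hcomp n (grLieHom_fun x);
  grLieHom_br : forall x y,
    grLieHom_fun (br x y) = br (grLieHom_fun x) (grLieHom_fun y) }.

Record dgLieHom (L L' : dgLie) := DGLieHom {
  dgLieHom_fun :> grLieHom L L';
  dgLieHom_diff : forall x, dgLieHom_fun (diff x) = diff (dgLieHom_fun x) }.

Definition simply_connected (L : dgLie) : Prop :=
  forall n : int, n < 1 -> hcomp (g := L) n = [set 0].

Definition cycles (L : dgLie) : set L := [set x | diff x = 0].

Definition coset (M : lmodType rat) (B : set M) (x : M) : set M :=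
  [set y | B (y - x)].

Definition boundaries (L : dgLie) (n : int) : set L := diff @` @hcomp L (n + 1).

Definition homology (L : dgLie) (n : int) : set (set L) :=
  [set coset (boundaries n) z | z in @cycles L `&` hcomp n].

(* The map induced on H_n: the coset z + B_n(L) goes to f z + B_n(L'). *)
Definition homology_map (L L' : dgLie) (f : dgLieHom L L') (n : int)
    (c : set L) : set L' :=
  [set y | exists2 x, c x & boundaries n (y - f x)].

Definition quasi_iso (L L' : dgLie) (f : dgLieHom L L') : Prop :=
  forall n : int,
    set_bij (@homology L n) (@homology L' n) (homology_map f n).

(* Degree 0 linear maps E -> L' from a graded subspace E of L, represented by
   functions on L whose values outside E are irrelevant. *)
Definition graded_linear_on (L L' : gradedSpace) (E : set L) (phi : L -> L') :
    Prop :=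
  (forall a x y, E x -> E y -> phi (a *: x + y) = a *: phi x + phi y) /\
  (forall n x, E x -> hcomp n x -> hcomp n (phi x)).

Definition free_on (L : grLie) (V : set L) : Prop :=
  graded_subspace V /\
  forall (L' : grLie) (phi : L -> L'), graded_linear_on V phi ->
    exists F : grLieHom L L',
      (forall v, V v -> F v = phi v) /\
      (forall G : grLieHom L L',
         (forall v, V v -> G v = phi v) -> forall x, G x = F x).

Record quasiFree := QuasiFree {
  qf_sort :> dgLie;
  gens : set qf_sort;
  gens_free : free_on gens }.
Arguments gens : clear implicits.

(* j : L(V) -> L(V (+) U) is the inclusion of the sub dg Lie algebra. *)
Definition KS_extension (Q Q' : quasiFree) (j : dgLieHom Q Q') (U : set Q') :
    Prop :=
  [/\ injective j,
      graded_subspace U,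
      gens Q' = sumset (j @` gens Q) U,
      (j @` gens Q) `&` U = [set 0]
    & forall u, U u -> (j @` @cycles Q) (diff u)].

Definition is_colimit (M : nat -> quasiFree)
    (j : forall n, dgLieHom (M n) (M n.+1))
    (C : dgLie) (leg : forall n, dgLieHom (M n) C) : Prop :=
  (forall n x, leg n.+1 (j n x) = leg n x) /\
  forall (D : dgLie) (c : forall n, dgLieHom (M n) D),
    (forall n x, c n.+1 (j n x) = c n x) ->
    exists F : dgLieHom C D,
      (forall n x, F (leg n x) = c n x) /\
      (forall G : dgLieHom C D,
         (forall n x, G (leg n x) = c n x) -> forall x, G x = F x).

(* The sequence M[0], M[1], M[2], ... with M[0] equal to Q. *)
Definition stages (Q : quasiFree) (M : nat -> quasiFree) (n : nat) : quasiFree :=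
  if n is m.+1 then M m else Q.

(* [rel_new n] is W^(n+1) inside M[n+1].  That the colimit is again free, on
   V (+) W with W = (+)_i W^i, is a consequence of the preceding data; it is
   recorded so that V, W and the projection onto W make sense in the colimit. *)
Record relDGLie (Q : quasiFree) := RelDGLie {
  rel_next : nat -> quasiFree;
  rel_trans : forall n, dgLieHom (stages Q rel_next n) (stages Q rel_next n.+1);
  rel_new : forall n, set (stages Q rel_next n.+1);
  rel_KS : forall n, KS_extension (rel_trans n) (@rel_new n);
  rel_sort :> dgLie;
  rel_leg : forall n, dgLieHom (stages Q rel_next n) rel_sort;
  rel_colimit : is_colimit rel_trans rel_leg;
  relW : set rel_sort;
  relW_sum : is_direct_sum relW (fun n => rel_leg n.+1 @` @rel_new n);
  rel_disjoint : (rel_leg 0%N @` gens Q) `&` relW = [set 0];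
  rel_free : free_on (sumset (rel_leg 0%N @` gens Q) relW) }.
Arguments relW {Q} r _.

Definition rel_incl (Q : quasiFree) (M : relDGLie Q) : dgLieHom Q M :=
  rel_leg M 0%N.

Definition relV (Q : quasiFree) (M : relDGLie Q) : set M :=
  rel_incl M @` gens Q.
Arguments relV {Q} M _.

(* The canonical projection L(V (+) W) -> W, with W viewed inside L(V (+) W):
   it kills brackets and restricts to the projection V (+) W -> W.  It is
   unique, since V (+) W generates. *)
Definition is_projW (Q : quasiFree) (M : relDGLie Q) (p : {linear M -> M}) :
    Prop :=
  [/\ forall x y, p (br x y) = 0,
      forall v, relV M v -> p v = 0
    & forall w, relW M w -> p w = w].

Definition minimal (Q : quasiFree) (M : relDGLie Q) : Prop :=
  exists2 p : {linear M -> M},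
    is_projW p & forall w, relW M w -> p (diff w) = 0.

(* Main.v *)
(* Write H_n for the degree n homology of the mapping cone of a map q, so that q is
   a quasi-isomorphism as soon as all H_n vanish.  Starting from f, whose cone is
   acyclic in degrees <= 0, suppose that q : M[n] -> g has H_i = 0 for i <= n, and
   adjoin W = H_(n+1) in degree n + 1: a class represented by a cycle (x, y), where
   dx = 0 and q x = dy, gives a generator w with dw = x and q w = y.  All degrees
   being >= 1, this changes nothing below degree n + 1 and adds exactly W in degree
   n + 1, so that now H_i = 0 for i <= n + 1.

   Minimality comes from the injectivity of W -> H_(n+1): if x = m + w, with m in
   M[n] and w in W, is a cycle of degree n + 1 whose image in g is a boundary, then
   w is a boundary in the cone of M[n], whence w = 0.  The differentials of the
   generators of degree n + 2 thus lie in M[n], in degree n + 1, where W does not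
   occur.

   Both M[n+1] and the colimit are given by generators and relations.  Since the
   relations are homogeneous, x |-> 2^n x on degree n extends to an automorphism,
   and the independence of its eigenspaces provides the grading. *)

From HB Require Import structures.
Require Import Defs.
From mathcomp Require Import all_boot all_order all_algebra.
From mathcomp Require Import boolp classical_sets functions.

Set Implicit Arguments.
Unset Strict Implicit.
Unset Printing Implicit Defensive.

Import Order.TTheory GRing.Theory Num.Theory.
Local Open Scope classical_set_scope.
Local Open Scope ring_scope.

(** * Linear maps, subspaces and direct sums *)

Lemma mk_linear (U V : lmodType rat) (f : U -> V) :
  linear f -> {F : {linear U -> V} | forall x, F x = f x}.
Proof.
by move=> hf; exists (HB.pack_for {linear U -> V} f
  (GRing.isLinear.Build rat U V *:%R f hf)).
Qed.

Lemma mk_bilinear (U U' V : lmodType rat) (f : U -> U' -> V) :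
  (forall u', linear (f ^~ u')) -> (forall u, linear (f u)) ->
  {F : {bilinear U -> U' -> V} | forall x y, F x y = f x y}.
Proof.
move=> hl hr.
have h : @bilinear_for rat U U' V *:%R *:%R f by split.
by exists (HB.pack_for {bilinear U -> U' -> V} f
  (@bilinear_isBilinear.Build rat U U' V *:%R *:%R f h)).
Qed.

Section Subspaces.
Variables (M : lmodType rat) (E : set M).
Hypothesis hE : subspace E.

Lemma sub0 : E 0. Proof. by case: hE. Qed.
Lemma subP a x y : E x -> E y -> E (a *: x + y). Proof. by case: hE => _; apply. Qed.
Lemma subD x y : E x -> E y -> E (x + y).
Proof. by move=> Ex Ey; rewrite -[x]scale1r; apply: subP. Qed.
Lemma subZ a x : E x -> E (a *: x).
Proof. by move=> Ex; rewrite -[_ *: _]addr0; apply: subP => //; apply: sub0. Qed.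
Lemma subN x : E x -> E (- x). Proof. by rewrite -scaleN1r; apply: subZ. Qed.
Lemma subB x y : E x -> E y -> E (x - y).
Proof. by move=> Ex Ey; apply: subD => //; apply: subN. Qed.
Lemma sub_sum (I : eqType) (s : seq I) (c : I -> M) :
  (forall i, i \in s -> E (c i)) -> E (\sum_(i <- s) c i).
Proof.
elim: s => [|i s IH] h; first by rewrite big_nil; apply: sub0.
rewrite big_cons; apply: subD; first by apply: h; rewrite mem_head.
by apply: IH => j js; apply: h; rewrite inE js orbT.
Qed.

End Subspaces.

Lemma subspace_image (M N : lmodType rat) (E : set M) (f : {linear M -> N}) :
  subspace E -> subspace (f @` E).
Proof.
move=> hE; split; first by exists 0; [apply: sub0|rewrite linear0].
move=> a _ _ [x Ex <-] [y Ey <-]; exists (a *: x + y); first exact: subP.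
by rewrite linearP.
Qed.

Lemma subspace_sumset (M : lmodType rat) (A B : set M) :
  subspace A -> subspace B -> subspace (sumset A B).
Proof.
move=> hA hB; split.
  by exists 0, 0; rewrite addr0; split=> //; apply: sub0.
move=> a _ _ [x [y [Ax By ->]]] [x' [y' [Ax' By' ->]]].
exists (a *: x + x'), (a *: y + y'); split; try exact: subP.
by rewrite scalerDr addrACA.
Qed.

Lemma big_extend (I : eqType) (V : nmodType) (s s' : seq I) (c : I -> V) :
  uniq s -> uniq s' -> {subset s <= s'} -> (forall i, i \notin s -> c i = 0) ->
  \sum_(i <- s) c i = \sum_(i <- s') c i.
Proof.
move=> us us' ss' h0; rewrite [RHS](bigID [in s]) /=.
rewrite [X in _ = _ + X]big1 ?addr0; last by move=> i /h0.
rewrite -[RHS]big_filter; apply: perm_big; apply: uniq_perm => //.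
  exact: filter_uniq.
move=> i; rewrite mem_filter; case si: (i \in s) => //=.
by rewrite ss'.
Qed.

Section Decomposition.
Variables (I : eqType) (M : lmodType rat) (E : I -> set M).
Hypothesis hE : forall i, subspace (E i).

Definition dspan : set M :=
  [set x | exists s (c : I -> M), (forall i, E i (c i)) /\ x = \sum_(i <- s) c i].

(** The normal form of a decomposition: [s] has no repetition and [c] vanishes outside [s], so that
    in a direct sum [c] is determined by [x]. *)
Definition decomposes (x : M) (s : seq I) (c : I -> M) :=
  [/\ uniq s, forall i, E i (c i), forall i, i \notin s -> c i = 0
    & x = \sum_(i <- s) c i].

(** An index occurring several times in [s] is kept once, with its term multiplied by its
    multiplicity. *)
Lemma dspan_decomposes x : dspan x -> exists s c, decomposes x s c.
Proof.
move=> [s [c [hc ->]]].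
exists (undup s), (fun i => if i \in s then (count_mem i s)%:R *: c i else 0).
split.
- exact: undup_uniq.
- by move=> i; case: ifP => _; [apply: subZ|apply: sub0].
- by move=> i; rewrite mem_undup => /negbTE ->.
rewrite -big_undup_iterop_count big_seq [RHS]big_seq; apply: eq_bigr => i.
rewrite mem_undup => ->; rewrite scaler_nat.
by case: (count_mem i s) => [|k]; rewrite ?mulr0n //= Monoid.iteropE iter_addr addr0.
Qed.

Lemma decomposes_lin a x y s s' c c' : decomposes x s c -> decomposes y s' c' ->
  decomposes (a *: x + y) (undup (s ++ s')) (fun i => a *: c i + c' i).
Proof.
move=> [us hc h0 ->] [us' hc' h0' ->]; split.
- exact: undup_uniq.
- by move=> i; apply: subP.
- move=> i; rewrite mem_undup mem_cat negb_or => /andP[/h0 -> /h0' ->].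
  by rewrite scaler0 addr0.
rewrite big_split -scaler_sumr; congr (_ *: _ + _); apply: big_extend => //;
  rewrite ?undup_uniq // => i; by rewrite mem_undup mem_cat => ->; rewrite ?orbT.
Qed.

Lemma dspan_sub : subspace dspan.
Proof.
split; first by exists [::], (fun=> 0); split=> [i|]; [apply: sub0|rewrite big_nil].
move=> a x y /dspan_decomposes [s [c h]] /dspan_decomposes [s' [c' h']].
have [_ hc _ e] := decomposes_lin a h h'.
by eexists _, _; split; [apply: hc|apply: e].
Qed.

Lemma decomposes_single i x : E i x ->
  decomposes x [:: i] (fun j => if j == i then x else 0).
Proof.
move=> hx; split=> //.
- by move=> j; case: eqP => [->|_] //; apply: sub0.
- by move=> j; rewrite inE => /negbTE ->.
- by rewrite big_seq1 eqxx.
Qed.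

Lemma dspan_gen i x : E i x -> dspan x.
Proof.
by move=> /decomposes_single [_ h _ e]; eexists _, _; split; [apply: h|apply: e].
Qed.

End Decomposition.

Section DirectSum.
Variables (I : eqType) (M : lmodType rat) (S : set M) (E : I -> set M).
Hypothesis hS : is_direct_sum S E.

Lemma dsum_comp i : subspace (E i). Proof. by case: hS. Qed.

Lemma dsum_decomposes x : S x -> exists s c, decomposes E x s c.
Proof.
by case: (hS) => _ hs _ /hs; apply: dspan_decomposes; apply: dsum_comp.
Qed.

Lemma decomposes0 s c : decomposes E 0 s c -> forall i, c i = 0.
Proof.
move=> [us hc h0 /esym e0] i; case: (boolP (i \in s)) => [|/h0 //].
by case: hS => _ _; apply.
Qed.

Lemma decomposes_uniq x s s' c c' : decomposes E x s c -> decomposes E x s' c' -> c = c'.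
Proof.
move=> h h'; apply/funext => i; have := decomposes_lin dsum_comp (-1) h h'.
rewrite scaleN1r addNr => /decomposes0/(_ i)/eqP.
by rewrite scaleN1r addrC subr_eq0 => /eqP.
Qed.

End DirectSum.

Lemma big_single (I : eqType) (V : nmodType) (s : seq I) (c : I -> V) i :
  uniq s -> i \in s -> (forall j, j != i -> c j = 0) -> \sum_(j <- s) c j = c i.
Proof.
move=> us si h; rewrite (bigD1_seq i) //= big1 ?addr0 //.
Qed.

(** * Homogeneous parts and graded subspaces *)

Section Components.
Variable M : gradedSpace.

Lemma hcomp_sub n : subspace (@hcomp M n).
Proof. exact: dsum_comp (comp_direct M) n. Qed.

Lemma hcomp0 n : hcomp n (0 : M).
Proof. exact: (sub0 (hcomp_sub n)). Qed.

Lemma comp_ex (x : M) : exists sc, decomposes (@hcomp M) x sc.1 sc.2.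
Proof. by have [//|s [c h]] := dsum_decomposes (comp_direct M) (x := x); exists (s, c). Qed.

(** Both come from one classical choice. By [compE], [hpart] does not depend on it; [supp] may
    contain indices whose part is 0. *)
Definition supp (x : M) : seq int := (projT1 (cid (comp_ex x))).1.
Definition hpart (n : int) (x : M) : M := (projT1 (cid (comp_ex x))).2 n.

Lemma comp_decomposes x : decomposes (@hcomp M) x (supp x) (hpart^~ x).
Proof. exact: projT2 (cid (comp_ex x)). Qed.

Lemma compP n x : hcomp n (hpart n x).
Proof. by case: (comp_decomposes x). Qed.

Lemma compE x s c n : decomposes (@hcomp M) x s c -> hpart n x = c n.
Proof.
move=> /(decomposes_uniq (comp_direct M) (comp_decomposes x)).
by move=> /(congr1 (@^~ n)).
Qed.

Lemma comp_lin n a x y : hpart n (a *: x + y) = a *: hpart n x + hpart n y.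
Proof.
exact: (compE n (decomposes_lin hcomp_sub a (comp_decomposes x) (comp_decomposes y))).
Qed.

Lemma comp_hcomp m n (x : M) : hcomp n x -> hpart m x = if m == n then x else 0.
Proof. by move=> /(decomposes_single hcomp_sub)/compE. Qed.

Lemma comp_sum x : x = \sum_(i <- supp x) hpart i x.
Proof. by case: (comp_decomposes x). Qed.

Lemma homog_ind (P : M -> Prop) :
  (forall x y, P x -> P y -> P (x + y)) -> (forall n x, hcomp n x -> P x) ->
  forall x, P x.
Proof.
move=> hD h x; rewrite (comp_sum x); elim: (supp x) => [|i s IH].
  by rewrite big_nil; apply: (h 0); apply: sub0; apply: hcomp_sub.
by rewrite big_cons; apply: hD => //; apply: h; apply: compP.
Qed.

Lemma graded_subspaceP (E : set M) :
  graded_subspace E <-> subspace E /\ forall n x, E x -> E (hpart n x).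
Proof.
split=> [hE|[hE hc]].
  have ES x : E x <-> exists s c, decomposes (fun n => E `&` hcomp n) x s c.
    split; first exact: dsum_decomposes.
    by case: hE => _ h _ [s [c [_ hc _ ->]]]; apply/h; exists s, c.
  split; last first.
    move=> n x /ES [s [c [us hc h0 hx]]].
    rewrite (@compE x s c); first by case: (hc n).
    by split=> // i; case: (hc i).
  split; first by apply/ES; exists [::], (fun=> 0); split=> [||//|];
    rewrite ?big_nil // => i; apply: sub0; apply: (dsum_comp hE).
  move=> a x y /ES [s [c h]] /ES [s' [c' h']]; apply/ES.
  by eexists _, _; apply: (decomposes_lin (dsum_comp hE) a h h').
split.
- move=> n; split; first by split; apply: sub0 => //; apply: hcomp_sub.
  by move=> a x y [? ?] [? ?]; split; apply: subP => //; apply: hcomp_sub.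
- move=> x; split=> [Ex|[s [c [h ->]]]].
    exists (supp x), (hpart^~ x); split; last exact: comp_sum.
    by move=> i; split; [apply: hc|apply: compP].
  by apply: sub_sum => // i _; case: (h i).
- move=> s c us h; case: (comp_direct M) => _ _; apply=> // i.
  by case: (h i).
Qed.

Lemma graded_sumset (A B : set M) :
  graded_subspace A -> graded_subspace B -> graded_subspace (sumset A B).
Proof.
move=> /graded_subspaceP[hA cA] /graded_subspaceP[hB cB]; apply/graded_subspaceP.
split; first exact: subspace_sumset.
move=> n _ [x [y [Ax By ->]]]; exists (hpart n x), (hpart n y); split; auto.
by rewrite -[x in LHS]scale1r comp_lin scale1r.
Qed.

(** Used with f n = 2^n, to separate the degrees of a presented Lie algebra, and with f n = (-1)^n,
    for the sign in the Leibniz rule. *)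
Lemma comp_scaling (f : int -> rat) :
  {F : {linear M -> M} | forall n x, hcomp n x -> F x = f n *: x}.
Proof.
pose F (x : M) := \sum_(i <- supp x) f i *: hpart i x.
have FE x s c : decomposes (@hcomp M) x s c -> F x = \sum_(i <- s) f i *: c i.
  move=> h; rewrite /F.
  have e i : hpart i x = c i by apply: compE h.
  under eq_bigr do rewrite e.
  case: h => us _ h0 _; case: (comp_decomposes x) => ux _ hx0 _.
  rewrite (@big_extend _ _ (supp x) (undup (supp x ++ s))) ?undup_uniq //.
  - rewrite [RHS](@big_extend _ _ s (undup (supp x ++ s))) ?undup_uniq //.
      by move=> i si; rewrite mem_undup mem_cat si orbT.
    by move=> i /h0 ->; rewrite scaler0.
  - by move=> i si; rewrite mem_undup mem_cat si.
  - by move=> i /hx0; rewrite e => ->; rewrite scaler0.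
have lF : linear F.
  move=> a x y.
  have hx := comp_decomposes x; have hy := comp_decomposes y.
  rewrite (FE _ _ _ (decomposes_lin hcomp_sub a hx hy)).
  set s := undup _.
  have sx : decomposes (@hcomp M) x s (hpart^~ x).
    case: hx => ux hx h0 ex; split=> //; first exact: undup_uniq.
      by move=> i; rewrite mem_undup mem_cat negb_or => /andP[/h0].
    rewrite {1}ex; apply: big_extend => //; first exact: undup_uniq.
    by move=> i si; rewrite mem_undup mem_cat si.
  have sy : decomposes (@hcomp M) y s (hpart^~ y).
    case: hy => uy hy h0 ey; split=> //; first exact: undup_uniq.
      by move=> i; rewrite mem_undup mem_cat negb_or => /andP[_ /h0].
    rewrite {1}ey; apply: big_extend => //; first exact: undup_uniq.
    by move=> i si; rewrite mem_undup mem_cat si orbT.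
  rewrite (FE _ _ _ sx) (FE _ _ _ sy) scaler_sumr -big_split; apply: eq_bigr => i _.
  by rewrite scalerDr !scalerA mulrC.
have [F' hF'] := mk_linear lF; exists F' => n x hx.
by rewrite hF' (FE _ _ _ (decomposes_single hcomp_sub hx)) big_seq1 eqxx.
Qed.

End Components.

Lemma graded_image (M N : gradedSpace) (f : {linear M -> N}) (E : set M) :
  (forall n x, hcomp n x -> hcomp n (f x)) ->
  graded_subspace E -> graded_subspace (f @` E).
Proof.
move=> hf /graded_subspaceP[hE cE]; apply/graded_subspaceP.
split; first exact: subspace_image.
move=> n _ [x Ex <-]; exists (hpart n x); first exact: cE.
apply/esym; apply: (@compE _ _ (supp x) (fun i => f (hpart i x))).
case: (comp_decomposes x) => us hx h0 ex; split.
- exact: us.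
- by move=> i; apply: hf; apply: hx.
- by move=> i /h0 ->; rewrite linear0.
- by rewrite {1}ex linear_sum.
Qed.

(** * Independence of eigenvectors, and signs *)

(** Applying [phi] minus the scalar [l k] to the relation removes the term of index [k] and
    multiplies the others by nonzero scalars; then induction applies. *)
Lemma eigen_indep (I : eqType) (V : lmodType rat) (phi : {linear V -> V})
    (l : I -> rat) (s : seq I) (c : I -> V) :
  injective l -> uniq s -> (forall i, phi (c i) = l i *: c i) ->
  \sum_(i <- s) c i = 0 -> forall i, i \in s -> c i = 0.
Proof.
move=> injl; elim: s c => [//|k s IH] c /= /andP[ks us] hc; rewrite big_cons => e0.
have e1 : \sum_(i <- s) (l i - l k) *: c i = 0.
  have : phi (c k + \sum_(i <- s) c i) - l k *: (c k + \sum_(i <- s) c i) = 0.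
    by rewrite e0 linear0 scaler0 subr0.
  rewrite linearD linear_sum hc scalerDr opprD addrACA subrr add0r scaler_sumr -sumrB.
  by move=> e1; rewrite -[RHS]e1; apply: eq_bigr => i _; rewrite hc scalerBl.
have h i : i \in s -> c i = 0.
  move=> si; have /IH : forall i, phi ((l i - l k) *: c i) = l i *: ((l i - l k) *: c i).
    by move=> j; rewrite linearZ hc /= !scalerA mulrC.
  move=> /(_ us e1 i si) /eqP; rewrite scaler_eq0 subr_eq0 => /orP[/eqP/injl ik|/eqP //].
  by move: ks; rewrite -ik si.
move=> i; rewrite inE => /orP[/eqP ->|/h //].
by move: e0; rewrite big_seq big1 ?addr0 // => j /h.
Qed.

Lemma expz2_inj : injective (fun n : int => (2%:R : rat) ^ n).
Proof. by apply: (@ieexprIz rat 2%:R). Qed.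

Lemma signD (m n : int) : (-1 : rat) ^ (m + n) = (-1) ^ m * (-1) ^ n.
Proof. by rewrite expfzDr // oppr_eq0 oner_neq0. Qed.

Lemma signN (n : int) : (-1 : rat) ^ (- n) = (-1) ^ n.
Proof. by rewrite -exprz_inv invrN invr1. Qed.

Lemma sign_sq (n : int) : (-1 : rat) ^ n * (-1) ^ n = 1.
Proof. by rewrite -{2}signN -signD subrr expr0z. Qed.

Lemma sign_pred (n : int) : (-1 : rat) ^ (n - 1) = - (-1) ^ n.
Proof. by rewrite signD signN expr1z mulrN1. Qed.

Lemma sign_predl (i j : int) : (-1 : rat) ^ ((i - 1) * j) = (-1) ^ (i * j) * (-1) ^ j.
Proof. by rewrite mulrBl mul1r signD signN. Qed.

Lemma sign_predr (i j : int) : (-1 : rat) ^ (i * (j - 1)) = (-1) ^ (i * j) * (-1) ^ i.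
Proof. by rewrite mulrBr mulr1 signD signN. Qed.

(** * Graded Lie algebras by generators and relations *)

(* A graded Lie algebra, except that the components are not required to be
   independent. *)
Record preLie := PreLie {
  pl_sort :> lmodType rat;
  pl_comp : int -> set pl_sort;
  pl_br : {bilinear pl_sort -> pl_sort -> pl_sort};
  pl_sub : forall n, subspace (pl_comp n);
  pl_br_comp : forall i j x y,
    pl_comp i x -> pl_comp j y -> pl_comp (i + j) (pl_br x y);
  pl_antisym : forall i j x y, pl_comp i x -> pl_comp j y ->
    pl_br x y = - ((-1) ^ (i * j) *: pl_br y x);
  pl_jacobi : forall i j x y z, pl_comp i x -> pl_comp j y ->
    pl_br x (pl_br y z) =
    pl_br (pl_br x y) z + (-1) ^ (i * j) *: pl_br y (pl_br x z) }.

Definition preLie_of (L : grLie) : preLie :=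
  @PreLie L (@hcomp L) (@br L) (@hcomp_sub L) (@br_comp L) (@br_antisym L)
    (@br_jacobi L).

Section Terms.
Variables (I : Type) (E : I -> gradedSpace).

(** Raw Lie expressions. Every element of every [E i] is a generator; the linear structure of [E i]
    is restored by [eqv_gen]. *)
Inductive term :=
| tgen i (x : E i)
| tzero
| tadd (s t : term)
| tscale (a : rat) (t : term)
| tbr (s t : term).

(* [tzero] is homogeneous of every degree. *)
Inductive hdeg : int -> term -> Prop :=
| hdeg_gen n i (x : E i) : hcomp n x -> hdeg n (tgen x)
| hdeg_zero n : hdeg n tzero
| hdeg_add n s t : hdeg n s -> hdeg n t -> hdeg n (tadd s t)
| hdeg_scale n a t : hdeg n t -> hdeg n (tscale a t)
| hdeg_br m n s t : hdeg m s -> hdeg n t -> hdeg (m + n) (tbr s t).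

Section Eval.
Variables (X : preLie) (v : forall i, E i -> X).

(** The target is a [preLie], so that terms can be evaluated in the presented algebra itself before
    its grading is known to be direct. *)
Fixpoint ev (t : term) : X :=
  match t with
  | tgen i x => v x
  | tzero => 0
  | tadd s t => ev s + ev t
  | tscale a t => a *: ev t
  | tbr s t => pl_br X (ev s) (ev t)
  end.

Hypothesis hv : forall i n (x : E i), hcomp n x -> pl_comp n (v x).

Lemma ev_comp n t : hdeg n t -> pl_comp n (ev t).
Proof.
elim=> {n t} /=.
- by move=> n i x; apply: hv.
- by move=> n; exact: (sub0 (pl_sub X n)).
- by move=> n s t _ hs _ ht; apply: subD => //; apply: pl_sub.
- by move=> n a t _ ht; apply: subZ => //; apply: pl_sub.
- by move=> m n s t _ hs _ ht; apply: pl_br_comp.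
Qed.

End Eval.

Variable R : term -> term -> Prop.

(** The congruence generated by the axioms of a graded Lie algebra, the linearity of [tgen] and the
    relations [R]. The signs in antisymmetry and Jacobi refer to degrees, hence the homogeneity of
    [s] and [t] there. *)
Inductive eqv : term -> term -> Prop :=
| eqv_refl t : eqv t t
| eqv_sym s t : eqv s t -> eqv t s
| eqv_trans s t u : eqv s t -> eqv t u -> eqv s u
| eqv_add s s' t t' : eqv s s' -> eqv t t' -> eqv (tadd s t) (tadd s' t')
| eqv_scale a t t' : eqv t t' -> eqv (tscale a t) (tscale a t')
| eqv_br s s' t t' : eqv s s' -> eqv t t' -> eqv (tbr s t) (tbr s' t')
| eqv_addA s t u : eqv (tadd s (tadd t u)) (tadd (tadd s t) u)
| eqv_addC s t : eqv (tadd s t) (tadd t s)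
| eqv_add0 t : eqv (tadd tzero t) t
| eqv_addN t : eqv (tadd (tscale (-1) t) t) tzero
| eqv_scaleA a b t : eqv (tscale a (tscale b t)) (tscale (a * b) t)
| eqv_scale1 t : eqv (tscale 1 t) t
| eqv_scaleDr a s t : eqv (tscale a (tadd s t)) (tadd (tscale a s) (tscale a t))
| eqv_scaleDl a b t : eqv (tscale (a + b) t) (tadd (tscale a t) (tscale b t))
| eqv_brl a s t u :
    eqv (tbr (tadd (tscale a s) t) u) (tadd (tscale a (tbr s u)) (tbr t u))
| eqv_brr a s t u :
    eqv (tbr u (tadd (tscale a s) t)) (tadd (tscale a (tbr u s)) (tbr u t))
| eqv_antisym i j s t : hdeg i s -> hdeg j t ->
    eqv (tbr s t) (tscale (- (-1) ^ (i * j)) (tbr t s))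
| eqv_jacobi i j s t u : hdeg i s -> hdeg j t ->
    eqv (tbr s (tbr t u))
      (tadd (tbr (tbr s t) u) (tscale ((-1) ^ (i * j)) (tbr t (tbr s u))))
| eqv_gen i a (x y : E i) :
    eqv (tgen (a *: x + y)) (tadd (tscale a (tgen x)) (tgen y))
| eqv_rel s t : R s t -> eqv s t.

Lemma ev_eqv (X : preLie) (v : forall i, E i -> X) :
  (forall i n (x : E i), hcomp n x -> pl_comp n (v i x)) ->
  (forall i, linear (v i)) -> (forall s t, R s t -> ev v s = ev v t) ->
  forall s t, eqv s t -> ev v s = ev v t.
Proof.
move=> hv lv hR s t; elim=> {s t} //=; try congruence.
- by move=> s t u; rewrite addrA.
- by move=> s t; rewrite addrC.
- by move=> t; rewrite add0r.
- by move=> t; rewrite scaleN1r addNr.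
- by move=> a b t; rewrite scalerA.
- by move=> t; rewrite scale1r.
- by move=> a s t; rewrite scalerDr.
- by move=> a b t; rewrite scalerDl.
- by move=> a s t u; rewrite linearPl.
- by move=> a s t u; rewrite linearPr.
- move=> i j s t /(ev_comp hv) hs /(ev_comp hv) ht.
  by rewrite (pl_antisym hs ht) scaleNr.
- move=> i j s t u /(ev_comp hv) hs /(ev_comp hv) ht.
  exact: pl_jacobi.
Qed.

(** The quotient by [eqv]: its elements are the equivalence classes, as sets of terms. *)
Definition pres := {A : set term | exists t, A = eqv t}.

HB.instance Definition _ := gen_eqMixin pres.
HB.instance Definition _ := gen_choiceMixin pres.

Definition pcls (t : term) : pres := exist _ (eqv t) (ex_intro _ t erefl).

Lemma pcls_eq s t : eqv s t -> pcls s = pcls t.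
Proof.
move=> st; apply: eq_exist; apply/seteqP; split=> u /= su.
  exact: eqv_trans (eqv_sym st) su.
exact: eqv_trans st su.
Qed.

Lemma eqv_pcls s t : pcls s = pcls t -> eqv s t.
Proof. by move=> [->]; apply: eqv_refl. Qed.

Definition prepr (x : pres) : term := projT1 (cid (proj2_sig x)).

Lemma preprK x : pcls (prepr x) = x.
Proof.
rewrite /prepr; case: cid => t /=; case: x => A hA /= e; exact/eq_exist.
Qed.

Lemma pclsK t : eqv (prepr (pcls t)) t.
Proof. by apply: eqv_pcls; rewrite preprK. Qed.

Lemma presP x : exists t, x = pcls t.
Proof. by exists (prepr x); rewrite preprK. Qed.

Definition padd x y := pcls (tadd (prepr x) (prepr y)).
Definition pscale a x := pcls (tscale a (prepr x)).
Definition pbr x y := pcls (tbr (prepr x) (prepr y)).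

Lemma paddE s t : padd (pcls s) (pcls t) = pcls (tadd s t).
Proof. by apply: pcls_eq; apply: eqv_add; apply: pclsK. Qed.
Lemma pscaleE a t : pscale a (pcls t) = pcls (tscale a t).
Proof. by apply: pcls_eq; apply: eqv_scale; apply: pclsK. Qed.
Lemma pbrE s t : pbr (pcls s) (pcls t) = pcls (tbr s t).
Proof. by apply: pcls_eq; apply: eqv_br; apply: pclsK. Qed.

Lemma paddA : associative padd.
Proof.
move=> x y z; have [[s ->] [t ->] [u ->]] := And3 (presP x) (presP y) (presP z).
by rewrite !paddE; apply: pcls_eq; apply: eqv_addA.
Qed.
Lemma paddC : commutative padd.
Proof.
move=> x y; have [[s ->] [t ->]] := conj (presP x) (presP y).
by rewrite !paddE; apply: pcls_eq; apply: eqv_addC.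
Qed.
Lemma padd0 : left_id (pcls tzero) padd.
Proof.
by move=> x; have [s ->] := presP x; rewrite !paddE; apply: pcls_eq; apply: eqv_add0.
Qed.
Lemma paddN : left_inverse (pcls tzero) (pscale (-1)) padd.
Proof.
move=> x; have [s ->] := presP x; rewrite !pscaleE !paddE.
by apply: pcls_eq; apply: eqv_addN.
Qed.

HB.instance Definition _ := GRing.isZmodule.Build pres paddA paddC padd0 paddN.

Lemma pscaleA a b x : pscale a (pscale b x) = pscale (a * b) x.
Proof. by have [s ->] := presP x; rewrite !pscaleE; apply: pcls_eq; apply: eqv_scaleA. Qed.
Lemma pscale1 : left_id 1 pscale.
Proof.
by move=> x; have [s ->] := presP x; rewrite pscaleE; apply: pcls_eq; apply: eqv_scale1.
Qed.
Lemma pscaleDr : right_distributive pscale +%R.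
Proof.
move=> a x y; have [[s ->] [t ->]] := conj (presP x) (presP y).
change (pscale a (padd (pcls s) (pcls t)) = padd (pscale a (pcls s)) (pscale a (pcls t))).
by rewrite paddE !pscaleE paddE; apply: pcls_eq; apply: eqv_scaleDr.
Qed.
Lemma pscaleDl x : {morph pscale^~ x : a b / a + b}.
Proof.
move=> a b; have [t ->] := presP x.
change (pscale (a + b) (pcls t) = padd (pscale a (pcls t)) (pscale b (pcls t))).
by rewrite !pscaleE paddE; apply: pcls_eq; apply: eqv_scaleDl.
Qed.

HB.instance Definition _ :=
  GRing.Zmodule_isLmodule.Build rat pres pscaleA pscale1 pscaleDr pscaleDl.

Lemma pclsD s t : pcls (tadd s t) = pcls s + pcls t. Proof. by rewrite -paddE. Qed.
Lemma pclsZ a t : pcls (tscale a t) = a *: pcls t. Proof. by rewrite -pscaleE. Qed.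

Lemma pbr_linl y : linear (pbr^~ y).
Proof.
move=> a x x'; have [[s ->] [t ->] [u ->]] := And3 (presP x) (presP x') (presP y).
by rewrite -pclsZ -pclsD !pbrE -pclsZ -pclsD; apply: pcls_eq; apply: eqv_brl.
Qed.
Lemma pbr_linr x : linear (pbr x).
Proof.
move=> a y y'; have [[s ->] [t ->] [u ->]] := And3 (presP y) (presP y') (presP x).
by rewrite -pclsZ -pclsD !pbrE -pclsZ -pclsD; apply: pcls_eq; apply: eqv_brr.
Qed.

Definition presBr : {bilinear pres -> pres -> pres} :=
  sval (mk_bilinear pbr_linl pbr_linr).

Lemma pclsB s t : pcls (tbr s t) = presBr (pcls s) (pcls t).
Proof. by rewrite (svalP (mk_bilinear pbr_linl pbr_linr)) pbrE. Qed.

Definition pcomp (n : int) : set pres := pcls @` hdeg n.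

Lemma pcomp_sub n : subspace (pcomp n).
Proof.
split; first by exists tzero => //; apply: hdeg_zero.
move=> a _ _ [s hs <-] [t ht <-]; exists (tadd (tscale a s) t).
  by apply: hdeg_add => //; apply: hdeg_scale.
by rewrite pclsD pclsZ.
Qed.

Lemma pbr_comp i j x y : pcomp i x -> pcomp j y -> pcomp (i + j) (presBr x y).
Proof.
move=> [s hs <-] [t ht <-]; exists (tbr s t); first exact: hdeg_br.
by rewrite pclsB.
Qed.

Lemma pbr_antisym i j x y : pcomp i x -> pcomp j y ->
  presBr x y = - ((-1) ^ (i * j) *: presBr y x).
Proof.
move=> [s hs <-] [t ht <-]; rewrite -scaleNr -!pclsB -pclsZ.
by apply: pcls_eq; apply: eqv_antisym.
Qed.

Lemma pbr_jacobi i j x y z : pcomp i x -> pcomp j y ->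
  presBr x (presBr y z) =
  presBr (presBr x y) z + (-1) ^ (i * j) *: presBr y (presBr x z).
Proof.
move=> [s hs <-] [t ht <-]; have [u ->] := presP z.
by rewrite -!pclsB -pclsZ -pclsD; apply: pcls_eq; apply: eqv_jacobi.
Qed.

Definition presPre : preLie :=
  PreLie pcomp_sub pbr_comp pbr_antisym pbr_jacobi.

Definition pgen i (x : E i) : pres := pcls (tgen x).

Lemma pgen_lin i : linear (@pgen i).
Proof. by move=> a x y; rewrite -pclsZ -pclsD; apply: pcls_eq; apply: eqv_gen. Qed.

Lemma pgen_comp i n (x : E i) : hcomp n x -> pcomp n (pgen x).
Proof. by move=> hx; exists (tgen x) => //; apply: hdeg_gen. Qed.

(** Brackets are left out, so that the same lemma yields the scaling automorphism, the morphisms and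
    the derivations. *)
Lemma pres_lift (X : lmodType rat) (h : term -> X) :
  (forall s t, eqv s t -> h s = h t) ->
  (forall s t, h (tadd s t) = h s + h t) ->
  (forall a t, h (tscale a t) = a *: h t) ->
  {F : {linear pres -> X} | forall t, F (pcls t) = h t}.
Proof.
move=> hE hD hZ.
have E' t : h (prepr (pcls t)) = h t by apply: hE; apply: pclsK.
have l : linear (fun x => h (prepr x)).
  move=> a x y; have [[s ->] [t ->]] := conj (presP x) (presP y).
  by rewrite -pclsZ -pclsD !E' hD hZ.
by have [F hF] := mk_linear l; exists F => t; rewrite hF E'.
Qed.

Hypothesis homR : forall s t, R s t -> exists n, hdeg n s /\ hdeg n t.

(* x |-> 2^n x on degree n is an automorphism because all the relations are
   homogeneous; its eigenspaces are the homogeneous components. *)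
Lemma pres_scaling :
  exists phi : {linear pres -> pres}, forall n x, pcomp n x -> phi x = 2%:R ^ n *: x.
Proof.
pose w i := sval (@comp_scaling (E i) (fun n => 2%:R ^ n)).
have hw i : forall n x, hcomp n x -> w i x = 2%:R ^ n *: x :=
  svalP (@comp_scaling (E i) _).
pose v i (x : E i) : presPre := pgen (w i x).
have evE n t : hdeg n t -> ev v t = 2%:R ^ n *: (pcls t : presPre).
  elim=> {n t} /=.
  - move=> n i x hx; rewrite /v (hw _ _ _ hx) -[_ *: x]addr0 pgen_lin.
    suff -> : pgen (0 : E i) = 0 by rewrite addr0.
    by have := pgen_lin (-1) (0 : E i) 0; rewrite scaler0 addr0 scaleN1r addNr.
  - by move=> n; rewrite scaler0.
  - by move=> n s t _ -> _ ->; rewrite -scalerDr pclsD.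
  - by move=> n a t _ ->; rewrite pclsZ !scalerA mulrC.
  - move=> m n s t _ -> _ ->; rewrite linearZl_LR linearZr_LR /= scalerA pclsB.
    by rewrite expfzDr.
have [|//|//|phi hphi] := @pres_lift presPre (ev v).
  apply: ev_eqv.
  - move=> i n x hx; apply: pgen_comp; rewrite (hw _ _ _ hx).
    by apply: subZ => //; apply: hcomp_sub.
  - by move=> i a x y; rewrite /v linearP pgen_lin.
  - move=> s t st; have [n [hs ht]] := homR st.
    by rewrite (evE _ _ hs) (evE _ _ ht) (pcls_eq (eqv_rel st)).
by exists phi => n _ [t ht <-]; rewrite hphi (evE _ _ ht).
Qed.

(** Induction on terms shows that homogeneous elements span. They are independent because the
    component of degree n consists of eigenvectors of eigenvalue 2^n, and these eigenvalues are
    distinct. *)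
Lemma pres_direct : is_direct_sum setT pcomp.
Proof.
split; first exact: pcomp_sub.
  move=> x; split=> // _; change (dspan pcomp x).
  have [t ->] := presP x; elim: t => {x}.
  - move=> i x; rewrite (comp_sum x).
    have [F hF] := mk_linear (@pgen_lin i); rewrite -[pcls _]hF linear_sum.
    apply: sub_sum => [|n _]; first exact: (dspan_sub pcomp_sub).
    by rewrite hF; apply: (dspan_gen pcomp_sub (i := n)); apply: pgen_comp; apply: compP.
  - exact: (sub0 (dspan_sub pcomp_sub)).
  - by move=> s hs t ht; rewrite pclsD; apply: subD => //; apply: (dspan_sub pcomp_sub).
  - by move=> a t ht; rewrite pclsZ; apply: subZ => //; apply: (dspan_sub pcomp_sub).
  - move=> s [ss [cs [hs es]]] t [st [ct [ht et]]]; rewrite pclsB es et.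
    rewrite linear_sumlz; apply: sub_sum => [|i _]; first exact: (dspan_sub pcomp_sub).
    rewrite linear_sumr; apply: sub_sum => [|j _]; first exact: (dspan_sub pcomp_sub).
    by apply: (dspan_gen pcomp_sub (i := i + j)); apply: pbr_comp.
move=> s c us hc e0.
have [phi hphi] := pres_scaling.
by apply: (eigen_indep (phi := phi) expz2_inj us) => // n; apply: hphi.
Qed.

Definition presGr : gradedSpace := GradedSpace pres_direct.

Definition presLie : grLie :=
  @GrLie presGr presBr pbr_comp pbr_antisym pbr_jacobi.

(** A homogeneous element is represented by a term with a derivation of [hdeg], on which the
    induction runs. The degree is an argument of [P], so that statements may depend on it. *)
Lemma pres_hcomp_ind (P : int -> presLie -> Prop) :
  (forall i n (x : E i), hcomp n x -> P n (pgen x)) ->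
  (forall n, P n 0) ->
  (forall n a (x y : presLie), hcomp n x -> hcomp n y -> P n x -> P n y ->
     P n (a *: x + y)) ->
  (forall m n (x y : presLie), hcomp m x -> hcomp n y -> P m x -> P n y ->
     P (m + n) (br x y)) ->
  forall n x, hcomp n x -> P n x.
Proof.
move=> hg h0 hl hb n _ [t ht <-]; elim: ht => {n t}.
- by move=> n i x hx; apply: hg.
- exact: h0.
- move=> n s t hs Ps ht Pt; rewrite pclsD -[pcls s]scale1r.
  by apply: hl => //; [exists s|exists t].
- move=> n a t ht Pt; rewrite pclsZ -[_ *: _]addr0.
  by apply: hl => //; [exists t|exact: (sub0 (pcomp_sub n))].
- move=> m n s t hs Ps ht Pt; rewrite pclsB.
  by apply: hb => //; [exists s|exists t].
Qed.

Lemma pres_hom (L : grLie) (v : forall i, E i -> L) :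
  (forall i n (x : E i), hcomp n x -> hcomp n (v i x)) ->
  (forall i, linear (v i)) ->
  (forall s t, R s t -> ev (X := preLie_of L) v s = ev (X := preLie_of L) v t) ->
  exists F : grLieHom presLie L, forall i (x : E i), F (pgen x) = v i x.
Proof.
move=> hv lv hR.
have hv' : forall i n (x : E i), hcomp n x -> pl_comp (p := preLie_of L) n (v i x) := hv.
have [|//|//|F hF] := @pres_lift L (ev (X := preLie_of L) v).
  exact: (@ev_eqv (preLie_of L) v hv' lv hR).
have Fc n (x : presLie) : hcomp n x -> hcomp n (F x).
  by move=> [t ht <-]; rewrite hF; apply: (ev_comp hv').
have Fb (x y : presLie) : F (br x y) = br (F x) (F y).
  have [[s ->] [t ->]] := conj (presP x) (presP y).
  by rewrite -[br _ _]pclsB !hF.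
by exists (@GrLieHom presLie L F Fc Fb) => i x; rewrite /= hF.
Qed.

(** * Derivations of degree -1 and the differential *)

Section Derivation.
Variable D : forall i, E i -> presLie.
Hypothesis hD : forall i n (x : E i), hcomp n x -> hcomp (n - 1) (D x).
Hypothesis lD : forall i, linear (@D i).

(** The sign involution, which lets the graded Leibniz rule be written for inhomogeneous elements as
    well. *)
Definition sigma : {linear presLie -> presLie} :=
  sval (@comp_scaling presLie (fun n => (-1) ^ n)).

Lemma sigmaE n (x : presLie) : hcomp n x -> sigma x = (-1) ^ n *: x.
Proof. exact: svalP (@comp_scaling presLie _) n x. Qed.

(** The derivation extending [D], first on terms, where the Leibniz rule is a recursive definition;
    [der_eqv] makes it descend to the quotient. *)
Fixpoint der (t : term) : presLie :=
  match t with
  | tgen i x => D x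
  | tzero => 0
  | tadd s t => der s + der t
  | tscale a t => a *: der t
  | tbr s t => br (der s) (pcls t : presLie) + br (sigma (pcls s)) (der t)
  end.

Lemma derG i (x : E i) : der (tgen x) = D x. Proof. by []. Qed.
Lemma der0 : der tzero = 0. Proof. by []. Qed.
Lemma derD s t : der (tadd s t) = der s + der t. Proof. by []. Qed.
Lemma derZ a t : der (tscale a t) = a *: der t. Proof. by []. Qed.
Lemma derB s t : der (tbr s t) =
  br (der s) (pcls t : presLie) + br (sigma (pcls s)) (der t).
Proof. by []. Qed.
Definition derE := (derG, der0, derD, derZ, derB).

Lemma der_comp n t : hdeg n t -> hcomp (n - 1) (der t).
Proof.
elim=> {n t}.
- by move=> n i x; apply: hD.
- by move=> n; exact: (sub0 (@hcomp_sub presLie (n - 1))).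
- by move=> n s t _ hs _ ht; rewrite derD; apply: subD => //; apply: hcomp_sub.
- by move=> n a t _ ht; rewrite derZ; apply: subZ => //; apply: hcomp_sub.
- move=> m n s t hs Ps ht Pt; rewrite derB; apply: subD; first exact: hcomp_sub.
    by rewrite addrAC; apply: br_comp => //; exists t.
  have hs' : hcomp (g := presLie) m (pcls s) by exists s.
  rewrite -addrA; apply: br_comp => //; rewrite (sigmaE hs').
  by apply: subZ => //; apply: hcomp_sub.
Qed.

Hypothesis derR : forall s t, R s t -> der s = der t.

Lemma pclsBr s t : pcls (tbr s t) = br (pcls s : presLie) (pcls t).
Proof. exact: pclsB. Qed.

Lemma der_eqv s t : eqv s t -> der s = der t.
Proof.
elim=> {s t} //; try (by move=> *; rewrite ?derE; congruence).
- by move=> s s' t t' ss es tt' et; rewrite !derE es et (pcls_eq ss) (pcls_eq tt').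
- by move=> s t u; rewrite !derE addrA.
- by move=> s t; rewrite !derE addrC.
- by move=> t; rewrite !derE add0r.
- by move=> t; rewrite !derE scaleN1r addNr.
- by move=> a b t; rewrite !derE scalerA.
- by move=> t; rewrite !derE scale1r.
- by move=> a s t; rewrite !derE scalerDr.
- by move=> a b t; rewrite !derE scalerDl.
- move=> a s t u; rewrite !derE pclsD pclsZ linearPl linearP linearPl /=.
  by rewrite scalerDr addrACA.
- move=> a s t u; rewrite !derE pclsD pclsZ !linearPr /=.
  by rewrite scalerDr addrACA.
- move=> i j s t hs ht.
  have hS : hcomp (g := presLie) i (pcls s) by exists s.
  have hT : hcomp (g := presLie) j (pcls t) by exists t.
  rewrite !derE (sigmaE hS) (sigmaE hT) !linearZl_LR /=.
  rewrite (br_antisym (der_comp hs) hT) (br_antisym hS (der_comp ht)).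
  rewrite sign_predl sign_predr scalerDr scalerN !scalerA mulrCA sign_sq mulr1.
  by rewrite mulNr !scaleNr addrC.
- move=> i j s t u hs ht.
  have hS : hcomp (g := presLie) i (pcls s) by exists s.
  have hT : hcomp (g := presLie) j (pcls t) by exists t.
  rewrite !derE !pclsBr (sigmaE hS) (sigmaE hT) (sigmaE (br_comp hS hT)).
  rewrite !(linearZl_LR, linearDl, linearDr, linearZr_LR) /=.
  rewrite (br_jacobi _ (der_comp hs) hT) (br_jacobi _ hS (der_comp ht)).
  rewrite (br_jacobi _ hS hT) sign_predl sign_predr signD !scalerDr !scalerA.
  rewrite [_ * (_ * (-1) ^ i)]mulrCA sign_sq mulr1.
  rewrite [_ * _ * (-1) ^ (i * j)]mulrC [(-1) ^ j * (-1) ^ i]mulrC.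
  (* On the left, Jacobi has split each of the three Leibniz terms in two; the six summands are
     regrouped into the derivatives of the two terms on the right. *)
  by rewrite [LHS](AC (2 * (2 * 2)) (((1 * 3) * 5) * (4 * (2 * 6)))).
Qed.

End Derivation.

Variables (tau : I -> I) (dl : forall i, E i -> E (tau i)).
Hypothesis dl_lin : forall i, linear (@dl i).
Hypothesis dl_hcomp : forall i n (x : E i), hcomp n x -> hcomp (n - 1) (dl x).

(** The differential of a generator is again a single generator. This is general enough here,
    because the families [E] used below contain whole Lie algebras. *)
Definition genD i (x : E i) : presLie := pgen (dl x).

Hypothesis derR : forall s t, R s t -> der genD s = der genD t.

Lemma pres_diff : exists d : {linear presLie -> presLie},
  [/\ forall i (x : E i), d (pgen x) = genD x,
      forall n x, hcomp n x -> hcomp (n - 1) (d x)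
    & forall i x y, hcomp i x -> d (br x y) = br (d x) y + (-1) ^ i *: br x (d y)].
Proof.
have lD i : linear (@genD i) by move=> a x y; rewrite /genD dl_lin pgen_lin.
have hD i n (x : E i) : hcomp n x -> hcomp (n - 1) (genD x).
  by move=> /dl_hcomp; apply: pgen_comp.
have [|//|//|d hd] := @pres_lift presLie (der genD).
  exact: der_eqv.
exists d; split.
- by move=> i x; rewrite hd.
- by move=> n _ [t ht <-]; rewrite hd; apply: der_comp.
move=> i x y hx; have [[s es] [t et]] := conj (presP x) (presP y).
by rewrite es et -[br _ _]pclsB !hd derB -es -et (sigmaE hx) linearZl_LR.
Qed.

End Terms.

(* C is the dg Lie algebra generated by the graded spaces E i subject to the
   relations R; its differential maps the generators E i to the generators
   E (tau i) through dl i. *)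
Record presents (I : Type) (E : I -> gradedSpace) (R : term E -> term E -> Prop)
    (tau : I -> I) (dl : forall i, E i -> E (tau i)) (C : dgLie)
    (gen : forall i, E i -> C) : Prop := Presents {
  gen_lin : forall i, linear (gen i);
  gen_hcomp : forall i n (x : E i), hcomp n x -> hcomp n (gen i x);
  gen_rel : forall s t, R s t ->
    ev (X := preLie_of C) gen s = ev (X := preLie_of C) gen t;
  gen_diff : forall i (x : E i), diff (gen i x) = gen (tau i) (dl i x);
  gen_hom : forall (L : grLie) (v : forall i, E i -> L),
    (forall i, linear (v i)) ->
    (forall i n (x : E i), hcomp n x -> hcomp n (v i x)) ->
    (forall s t, R s t -> ev (X := preLie_of L) v s = ev (X := preLie_of L) v t) ->
    exists F : grLieHom C L, forall i (x : E i), F (gen i x) = v i x;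
  gen_ind : forall P : int -> C -> Prop,
    (forall i n (x : E i), hcomp n x -> P n (gen i x)) ->
    (forall n, P n 0) ->
    (forall n a x y, hcomp n x -> hcomp n y -> P n x -> P n y -> P n (a *: x + y)) ->
    (forall m n x y, hcomp m x -> hcomp n y -> P m x -> P n y ->
       P (m + n) (br x y)) ->
    forall n x, hcomp n x -> P n x }.

Lemma presentation (I : Type) (E : I -> gradedSpace) (R : term E -> term E -> Prop)
    (tau : I -> I) (dl : forall i, E i -> E (tau i))
    (homR : forall s t, R s t -> exists n, hdeg n s /\ hdeg n t) :
  (forall i, linear (dl i)) ->
  (forall i n (x : E i), hcomp n x -> hcomp (n - 1) (dl i x)) ->
  (forall i (x : E i), dl (tau i) (dl i x) = 0) ->
  (forall s t, R s t ->
     der (genD homR dl) s = der (genD homR dl) t) ->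
  exists C gen, @presents I E R tau dl C gen.
Proof.
move=> ldl hdl dldl derR.
have [d [dg dc db]] := pres_diff ldl hdl derR.
have dd n (x : presLie homR) : hcomp n x -> d (d x) = 0.
  move: n x; apply: pres_hcomp_ind.
  - move=> i n x hx; rewrite dg /genD dg /genD dldl.
    have [F hF] := mk_linear (@pgen_lin I E R (tau (tau i))).
    by rewrite -hF linear0.
  - by move=> n; rewrite !linear0.
  - by move=> n a x y _ _ hx hy; rewrite !linearP hx hy scaler0 addr0.
  - move=> m n x y hx hy ex ey; rewrite (db _ _ _ hx) linearD linearZ /=.
    rewrite (db _ _ _ (dc _ _ hx)) (db _ _ _ hx) ex ey.
    rewrite linear0l linear0r scaler0 !add0r addr0.
    (* The two copies of [dx, dy] cancel, as dx has degree m - 1. *)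
    by rewrite sign_pred scaleNr addNr.
have dK x : d (d x) = 0.
  move: x; apply: homog_ind; last exact: dd.
  by move=> x y hx hy; rewrite !linearD hx hy addr0.
exists (DGLie dc dK db), (@pgen I E R); split.
- by move=> i; apply: pgen_lin.
- by move=> i n x; apply: pgen_comp.
- move=> s t st.
  have e u : ev (X := preLie_of (presLie homR)) (@pgen I E R) u = pcls R u.
    elim: u => //=.
    + by move=> u -> v ->; rewrite pclsD.
    + by move=> a u ->; rewrite pclsZ.
    + by move=> u -> v ->; rewrite pclsB.
  by rewrite [LHS]e [RHS]e; apply: pcls_eq; apply: eqv_rel.
- exact: dg.
- by move=> L v lv hv hR; apply: pres_hom.
- exact: pres_hcomp_ind.
Qed.

Section Presented.
Variables (I : Type) (E : I -> gradedSpace) (R : term E -> term E -> Prop).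
Variables (tau : I -> I) (dl : forall i, E i -> E (tau i)).
Variables (C : dgLie) (gen : forall i, E i -> C).
Hypothesis pC : presents R dl gen.

Lemma gen_uniq (L : grLie) (F G : grLieHom C L) :
  (forall i (x : E i), F (gen x) = G (gen x)) -> forall x, F x = G x.
Proof.
move=> h; apply: homog_ind => [x y hx hy|n x]; first by rewrite !linearD hx hy.
move: n x; apply: (gen_ind pC).
- by move=> i n x _; apply: h.
- by move=> n; rewrite !linear0.
- by move=> n a x y _ _ hx hy; rewrite !linearP hx hy.
- by move=> m n x y _ _ hx hy; rewrite !grLieHom_br hx hy.
Qed.

(** Since [F] preserves brackets and degrees, both composites with the differential obey the same
    Leibniz rule; agreement on generators propagates. *)
Lemma gen_dghom (L : dgLie) (F : grLieHom C L) :
  (forall i (x : E i), F (gen (dl x)) = diff (F (gen x))) ->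
  forall x, F (diff x) = diff (F x).
Proof.
move=> h; apply: homog_ind => [x y hx hy|n x]; first by rewrite !linearD hx hy.
move: n x; apply: (gen_ind pC).
- by move=> i n x _; rewrite (gen_diff pC) h.
- by move=> n; rewrite !linear0.
- by move=> n a x y _ _ hx hy; rewrite !linearP hx hy.
- move=> m n x y hx _ ex ey; rewrite (diff_br _ hx) linearD linearZ !grLieHom_br ex ey /=.
  by rewrite (diff_br _ (grLieHom_comp F hx)).
Qed.

End Presented.

(** * Morphisms of graded Lie algebras *)

Lemma mk_grLieHom (L L' : grLie) (f : L -> L') : linear f ->
  (forall n x, hcomp n x -> hcomp n (f x)) ->
  (forall i j x y, hcomp i x -> hcomp j y -> f (br x y) = br (f x) (f y)) ->
  {F : grLieHom L L' | forall x, F x = f x}.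
Proof.
move=> /mk_linear [F hF] hc hb.
have Fc n x : hcomp n x -> hcomp n (F x) by rewrite hF; apply: hc.
have Fb x y : F (br x y) = br (F x) (F y).
  move: x; apply: homog_ind => [x x' hx hx'|i x hx].
    by rewrite linearDl !linearD linearDl hx hx'.
  move: y; apply: homog_ind => [y y' hy hy'|j y hy].
    by rewrite !linearD hy hy'.
  by rewrite !hF; apply: hb hx hy.
by exists (GrLieHom Fc Fb).
Qed.

Lemma comp_linear (U V W : lmodType rat) (f : {linear V -> W}) (h : {linear U -> V}) :
  linear (f \o h).
Proof. by move=> a x y /=; rewrite !linearP. Qed.

Lemma grLieHom_compose (L L' L'' : grLie) (f : grLieHom L' L'') (h : grLieHom L L') :
  {F : grLieHom L L'' | forall x, F x = f (h x)}.
Proof.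
apply: (mk_grLieHom (f := f \o h)); first exact: comp_linear.
- by move=> n x hx; do 2!apply: grLieHom_comp.
- by move=> i j x y _ _ /=; rewrite !grLieHom_br.
Qed.

Lemma grLieHom_id (L : grLie) : {F : grLieHom L L | forall x, F x = x}.
Proof. exact: (mk_grLieHom (f := id)). Qed.

Lemma graded_setT (M : gradedSpace) : graded_subspace (setT : set M).
Proof. by apply/graded_subspaceP; split. Qed.

(** * A vector space placed in a single degree *)

Section Concentrated.
Variables (W : lmodType rat) (N : int).

Definition conc_comp (n : int) : set W := if n == N then setT else [set 0].

Lemma conc_direct : is_direct_sum setT conc_comp.
Proof.
have hE n : subspace (conc_comp n).
  rewrite /conc_comp; case: ifP => _; split=> // a x y /= -> ->.
  by rewrite scaler0 addr0.
split=> // [x|s c us hc e0 i si].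
  split=> // _; change (dspan conc_comp x).
  by apply: (dspan_gen hE (i := N)); rewrite /conc_comp eqxx.
have c0 j : j != N -> c j = 0.
  by move=> jN; have := hc j; rewrite /conc_comp (negbTE jN).
have [iN|/c0 //] := eqVneq i N.
by rewrite -e0 (big_single us si) // => j; rewrite iN => /c0.
Qed.

Definition conc : gradedSpace := GradedSpace conc_direct.

End Concentrated.

(** * Attaching generators in a single degree *)

(* q' : Q' -> g extends q along the KS-extension j : Q -> Q' that adjoins a copy
   of W in degree N, with d w = a w and q' w = b w. *)
Record attached (Q : quasiFree) (g : dgLie) (q : dgLieHom Q g) (N : int)
    (W : lmodType rat) (a : W -> Q) (b : W -> g)
    (Q' : quasiFree) (j : dgLieHom Q Q') (w : {linear W -> Q'}) (q' : dgLieHom Q' g) :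
    Prop := Attached {
  att_KS : KS_extension j (range w);
  att_j : forall x, q' (j x) = q x;
  att_w : forall v, q' (w v) = b v;
  att_hcomp : forall v, hcomp N (w v);
  att_diff : forall v, diff (w v) = j (a v);
  att_retract : exists r : grLieHom Q' Q, (forall x, r (j x) = x) /\ forall v, r (w v) = 0;
  att_sc : simply_connected Q';
  att_low : forall n x, n <= N -> hcomp n x ->
    exists y v, [/\ hcomp n y, x = j y + w v & n < N -> v = 0];
  att_indec : forall (X : lmodType rat) (p : {linear Q' -> X}) k,
    (forall x y, p (br x y) = 0) -> k != N ->
    (forall x, hcomp k x -> p (j x) = 0) -> forall x, hcomp k x -> p x = 0 }.

Section Attach.
Variables (Q : quasiFree) (g : dgLie) (q : dgLieHom Q g) (N : int).
Variables (W : lmodType rat) (a : {linear W -> Q}) (b : {linear W -> g}).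
Hypotheses (N0 : 0 < N) (hQ : simply_connected Q).
Hypotheses (ha : forall v, hcomp (N - 1) (a v)) (hb : forall v, hcomp N (b v)).
Hypotheses (da : forall v, diff (a v) = 0) (qa : forall v, q (a v) = diff (b v)).

Definition attE (i : bool) : gradedSpace := 
  match i return gradedSpace with true => Q | false => conc W N end.

Definition att_dl (i : bool) : attE i -> attE true :=
  match i with true => diff | false => a end.

(** The relations say that the map from [Q] preserves brackets. They are stated for homogeneous
    elements, so that both sides have a common degree. *)
Inductive att_rel : term attE -> term attE -> Prop :=
| AttRel m n (x y : Q) : hcomp m x -> hcomp n y ->
    att_rel (tgen (E := attE) (i := true) (br x y))
      (tbr (tgen (E := attE) (i := true) x) (tgen (E := attE) (i := true) y)).

Lemma att_homR s t : att_rel s t -> exists n, hdeg n s /\ hdeg n t.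
Proof.
case=> m n x y hx hy; exists (m + n); split.
  by apply: hdeg_gen; apply: br_comp.
by apply: hdeg_br; apply: hdeg_gen.
Qed.

Lemma conc_hcomp n (v : conc W N) : hcomp n v -> n = N \/ v = 0.
Proof. by rewrite /hcomp /= /conc_comp; case: eqP; [left|right]. Qed.

Lemma att_presentation : exists C gen, @presents _ attE att_rel (fun=> true) att_dl C gen.
Proof.
apply: (presentation (homR := att_homR)).
- by case; apply: linearP.
- case=> n x /=; first exact: diff_comp.
  by move=> /conc_hcomp [->|->]; [apply: ha|rewrite linear0; apply: hcomp0].
- by case=> x /=; [apply: diffK|apply: da].
- move=> s t [m n x y hx hy].
  have hX : hcomp (g := presLie att_homR) m (pgen att_rel (i := true) x).
    exact: (@pgen_comp _ attE att_rel true m x hx).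
  have relE m' n' (x' y' : Q) : hcomp m' x' -> hcomp n' y' ->
      pgen att_rel (i := true) (br x' y') =
      br (pgen att_rel (i := true) x' : presLie att_homR) (pgen att_rel (i := true) y').
    move=> hx' hy'; apply: etrans (pcls_eq (eqv_rel (AttRel hx' hy'))) _.
    exact: pclsB.
  rewrite derB !derG /genD /= (diff_br y hx) addrC pgen_lin addrC.
  rewrite (relE _ _ _ _ (diff_comp hx) hy) (relE _ _ _ _ hx (diff_comp hy)).
  by rewrite (sigmaE hX) linearZl_LR.
Qed.

(** [Q'] is presented by all of [Q] together with W in degree N. Hence a morphism of graded Lie
    algebras out of it is a morphism on [Q] and an arbitrary linear map on W into degree N ([univ],
    [uniq]), from which the retraction, [q'] and freeness follow. *)
Lemma attach :
  exists (Q' : quasiFree) (j : dgLieHom Q Q') (w : {linear W -> Q'}) (q' : dgLieHom Q' g),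
  attached q N a b j w q'.
Proof.
have [C [gen pC]] := att_presentation.
have genE m n (x y : Q) : hcomp m x -> hcomp n y ->
    gen true (br x y) = br (gen true x) (gen true y).
  by move=> hx hy; apply: (gen_rel pC (AttRel hx hy)).
have [j0 j0E] :=
  mk_grLieHom (L := Q) (gen_lin pC (i := true)) (gen_hcomp pC (i := true)) genE.
have jd x : j0 (diff x) = diff (j0 x) by rewrite !j0E (gen_diff pC).
pose j := DGLieHom jd; have jE x : j x = gen true x := j0E x.
have [w wE] := mk_linear (U := W) (gen_lin pC (i := false)).
have whc v : hcomp N (w v).
  by rewrite wE; apply: (gen_hcomp pC (i := false)); rewrite /hcomp /= /conc_comp eqxx.
have univ (L : grLie) (F0 : grLieHom Q L) (c : W -> L) : linear c ->
    (forall v, hcomp N (c v)) ->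
    exists F : grLieHom C L, (forall x, F (j x) = F0 x) /\ forall v, F (w v) = c v.
  move=> lc hc.
  pose v i : attE i -> L := match i with true => F0 | false => c end.
  have [|||F hF] := gen_hom pC (v := v).
  - by case; [apply: linearP|].
  - case=> n x /=; first exact: grLieHom_comp.
    move=> /conc_hcomp [->|->]; first exact: hc.
    have [c' hc'] := mk_linear lc.
    by rewrite -hc' linear0; apply: hcomp0.
  - by move=> s t [m n x y hx hy] /=; rewrite grLieHom_br.
  by exists F; split=> [x|x]; rewrite ?jE ?wE hF.
have uniq (L : grLie) (F G : grLieHom C L) : (forall x, F (j x) = G (j x)) ->
    (forall v, F (w v) = G (w v)) -> forall x, F x = G x.
  move=> h1 h2; apply: (gen_uniq pC) => -[] x; first by rewrite -jE.
  by rewrite -wE.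
(* Killing W is in general not compatible with the differential, so [r] is only a morphism of graded
   Lie algebras; it is enough for injectivity of [j]. *)
have [r [rj rw]] : exists r : grLieHom C Q,
    (forall x, r (j x) = x) /\ forall v, r (w v) = 0.
  have [F0 hF0] := grLieHom_id Q.
  have [||r [rj rw]] := univ _ F0 (fun=> 0).
  - by move=> k x y; rewrite scaler0 addr0.
  - by move=> v; apply: hcomp0.
  by exists r; split=> // x; rewrite rj.
have [q0 [q0j q0w]] := univ g q b (linearP b) hb.
have q0d x : q0 (diff x) = diff (q0 x).
  move: x; apply: (gen_dghom pC) => -[] x /=.
    by rewrite -!jE !q0j dgLieHom_diff.
  by rewrite -jE -wE q0j q0w qa.
have gU : graded_subspace (range w).
  rewrite -[range w]/((w : {linear conc W N -> C}) @` setT).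
  apply: graded_image; last exact: graded_setT.
  by move=> n x /conc_hcomp [->|->]; [apply: whc|rewrite linear0; apply: hcomp0].
have [gQ freeQ] := gens_free Q.
have gV : graded_subspace (j @` gens Q).
  by apply: graded_image => // n x; apply: grLieHom_comp.
have [sV _] := (graded_subspaceP _).1 gV.
have [sU _] := (graded_subspaceP _).1 gU.
have Vin x : gens Q x -> sumset (j @` gens Q) (range w) (j x).
  by move=> hx; exists (j x), 0; rewrite addr0; split; [exists x|apply: sub0|].
have Uin v : sumset (j @` gens Q) (range w) (w v).
  by exists 0, (w v); rewrite add0r; split; [apply: sub0|exists v|].
have fC : free_on (sumset (j @` gens Q) (range w)).
  split; first exact: graded_sumset.
  move=> L phi [lphi hphi].
  have [|F0 [F0E F0U]] := freeQ L (phi \o j).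
    split=> [k x y hx hy|n x hx hn] /=.
      by rewrite linearP lphi //; apply: Vin.
    by apply: hphi; [apply: Vin|apply: grLieHom_comp].
  have [||F [Fj Fw]] := univ L F0 (phi \o w).
  - by move=> k x y /=; rewrite linearP lphi.
  - by move=> v; apply: hphi.
  exists F; split=> [_ [_ [_ [[x hx <-] [v _ <-] ->]]]|G hG].
    rewrite linearD Fj Fw F0E // -[j x in RHS]scale1r lphi ?scale1r //; exact: Vin.
  apply: uniq => [x|v]; last by rewrite Fw; apply: hG.
  have [Gj hGj] := grLieHom_compose G j.
  by rewrite Fj -hGj; apply: F0U => v hv; rewrite hGj; apply: hG; apply: Vin.
(* Vanishing in degrees below 1 and the description up to degree N are proved together, as the
   second uses the first on the factors of a bracket. *)
have low n x : hcomp (g := C) n x -> (n < 1 -> x = 0) /\ (n <= N ->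
    exists y v, [/\ hcomp n y, x = j y + w v & n < N -> v = 0]).
  have case0 m : exists y v, [/\ hcomp m y, 0 = j y + w v & m < N -> v = 0].
    by exists 0, 0; rewrite !linear0 addr0; split=> //; apply: hcomp0.
  move: n x; apply: (gen_ind pC).
  - case=> n x hx; [rewrite -jE|rewrite -wE]; split=> [n1|nN].
    + have : [set 0] x by rewrite -(hQ n1).
      by move=> ->; rewrite linear0.
    + by exists x, 0; rewrite linear0 addr0.
    + case/conc_hcomp: hx => [e|->]; last by rewrite linear0.
      by move: n1; rewrite e ltNge -gtz0_ge1 N0.
    + exists 0, x; rewrite linear0 add0r; split=> //; first apply: hcomp0.
      by case/conc_hcomp: hx => [->|->//]; rewrite ltxx.
  - by move=> n; split=> // _; apply: case0.
  - move=> n k x y _ _ [x0 xl] [y0 yl]; split=> [n1|nN].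
      by rewrite x0 // y0 // scaler0 addr0.
    have [x1 [v1 [hx1 -> z1]]] := xl nN; have [y1 [u1 [hy1 -> z2]]] := yl nN.
    exists (k *: x1 + y1), (k *: v1 + u1); split.
    + by apply: subP => //; apply: hcomp_sub.
    + by rewrite !linearP scalerDr addrACA.
    + by move=> nN'; rewrite z1 // z2 // scaler0 addr0.
  (* Unless a factor vanishes, both degrees are positive; if their sum is at most N, each is less
     than N, so neither factor involves W. *)
  - move=> m n x y hx hy [x0 xl] [y0 yl].
    have [m1|m1] := ltP m 1; first by rewrite x0 // linear0l; split=> // _; apply: case0.
    have [n1|n1] := ltP n 1; first by rewrite y0 // linear0r; split=> // _; apply: case0.
    split=> [|mnN].
      by rewrite ltNge (le_trans m1) // lerDl (le_trans ler01).
    have mN : m < N by rewrite (lt_le_trans _ mnN) // ltrDl (lt_le_trans ltr01).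
    have nN : n < N by rewrite (lt_le_trans _ mnN) // ltrDr (lt_le_trans ltr01).
    have [x1 [v1 [hx1 -> z1]]] := xl (ltW mN); have [y1 [u1 [hy1 -> z2]]] := yl (ltW nN).
    rewrite z1 // z2 // linear0 !addr0; exists (br x1 y1), 0.
    by rewrite linear0 addr0 grLieHom_br; split=> //; apply: br_comp.
exists (QuasiFree fC), j, w, (DGLieHom q0d : dgLieHom (QuasiFree fC) g); split=> //.
- split=> //.
  + by move=> x y e; rewrite -[x]rj -[y]rj e.
  + apply/seteqP; split=> [_ [[x _ <-] [v _ e]]|_ ->].
      by rewrite -[x]rj -e rw linear0.
    by split; [apply: sub0|apply: sub0].
  + move=> _ [v _ <-]; exists (a v); first exact: da.
    by rewrite jE wE (gen_diff pC).
- by move=> v; rewrite jE wE (gen_diff pC).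
- by exists r.
- move=> n n1; apply/seteqP; split=> x /=; first by move=> /low [/(_ n1)].
  by move=> ->; apply: (sub0 (@hcomp_sub C n)).
- by move=> n x nN /low [_ /(_ nN)].
(* The generators from W have degree N and [p] kills brackets, so in degree k only elements coming
   from [Q] contribute. *)
- move=> X p k pb kN hp x hx.
  suff h n (y : C) : hcomp n y -> n = k -> p y = 0 by apply: (h k).
  move: n y; apply: (gen_ind pC) => {x hx}.
  + case=> n x hx e; subst n; first by rewrite -jE; apply: hp.
    by rewrite -wE; case/conc_hcomp: hx kN => [->|->]; rewrite ?eqxx ?linear0.
  + by move=> n _; rewrite linear0.
  + by move=> n l x y _ _ hx hy e; rewrite linearP hx // hy // scaler0 addr0.
  + by move=> *; apply: pb.
Qed.

End Attach.

(** * One step of the construction *)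

Section SubspaceType.
Variables (M : lmodType rat) (E : set M) (hE : subspace E).

Definition subspace_pred of subspace E : pred M := fun x => `[< E x >].

Lemma subspace_pred_closed : submod_closed (subspace_pred hE).
Proof.
split; first exact/asboolP/(sub0 hE).
by move=> a x y /asboolP Ex /asboolP Ey; apply/asboolP; apply: subP.
Qed.

HB.instance Definition _ :=
  GRing.isSubmodClosed.Build rat M (subspace_pred hE) subspace_pred_closed.

Definition subspace_type := {x : M | subspace_pred hE x}.
HB.instance Definition _ := SubChoice.on subspace_type.
HB.instance Definition _ := [SubChoice_isSubLmodule of subspace_type by <:].

End SubspaceType.

Lemma subspace_lmod (M : lmodType rat) (E : set M) : subspace E ->
  exists (W : lmodType rat) (i : {linear W -> M}), injective i /\ range i = E.
Proof.
move=> hE; exists (subspace_type hE : lmodType rat).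
have [i hi] := @mk_linear (subspace_type hE) M val (linearP _).
exists i; split; first by move=> x y; rewrite !hi; apply: val_inj.
apply/seteqP; split=> [_ [x _ <-]|x Ex].
  by rewrite hi; apply/asboolP; apply: valP x.
by exists (exist _ x (asboolT Ex)) => //; rewrite hi.
Qed.

(** Zorn's lemma, applied to the linearly closed subsets of [Z] that meet [B] at most in 0. *)
Lemma complement (M : lmodType rat) (B Z : set M) :
  subspace B -> subspace Z -> B `<=` Z ->
  exists W : set M, [/\ subspace W, W `<=` Z, W `&` B `<=` [set 0]
    & forall z, Z z -> exists w b, [/\ W w, B b & z = w + b]].
Proof.
move=> hB hZ BZ.
(* [P] does not ask for 0, so that the union of the empty chain, which is empty, satisfies it; a
   maximal set contains 0 because {0} satisfies [P]. *)
pose P (A : set M) := [/\ forall a x y, A x -> A y -> A (a *: x + y),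
  A `<=` Z & A `&` B `<=` [set 0]].
have [F FP Ftot|A [[Al AZ AB] Amax]] := @Zorn_bigcup M P.
  split.
  - move=> a x y [X FX Xx] [Y FY Yy].
    have [XY|YX] := Ftot _ _ FX FY.
      by exists Y => //; have [h _ _] := FP _ FY; apply: h => //; apply: XY.
    by exists X => //; have [h _ _] := FP _ FX; apply: h => //; apply: YX.
  - by move=> x [X /FP [_ h _]]; apply: h.
  - by move=> x [[X /FP [_ _ h] Xx] Bx]; apply: h.
have A0 : A 0.
  apply: contrapT => nA0; apply: (Amax [set 0]).
    split=> [x Ax|h]; last by apply: nA0; apply: h.
    by case: nA0; have := Al (-1) x x Ax Ax; rewrite scaleN1r addNr.
  split; first by move=> a x y /= -> ->; rewrite scaler0 addr0.
    by move=> x /= ->; apply: sub0.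
  by move=> x [].
have hA : subspace A by split.
exists A; split=> // z Zz; apply: contrapT => nz.
pose A' := sumset A (range (fun a : rat => a *: z)).
have hA' : subspace A'.
  apply: subspace_sumset => //; split; first by exists 0 => //; rewrite scale0r.
  move=> a _ _ [k _ <-] [l _ <-]; exists (a * k + l) => //.
  by rewrite scalerDl scalerA.
apply: (Amax A').
  split=> [x Ax|h].
    by exists x, 0; rewrite addr0; split=> //; exists 0 => //; rewrite scale0r.
  apply: nz; exists z, 0; rewrite addr0; split=> //; last exact: sub0.
  by apply: h; exists 0, z; rewrite add0r; split=> //; exists 1 => //; rewrite scale1r.
split; first by case: hA'.
  by move=> _ [x [_ [Ax [k _ <-] ->]]]; apply: subD => //; [apply: AZ|apply: subZ].
move=> _ [[x [_ [Ax [k _ <-] ->]]] Bxz] /=.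
have [k0|k0] := eqVneq k 0.
  by move: Bxz; rewrite k0 scale0r addr0 => Bx; apply: AB.
(* If x + k z lies in [B] with k nonzero, solving for z writes it as a sum of elements of [A] and
   [B]. *)
case: nz; exists (- (k^-1 *: x)), (k^-1 *: (x + k *: z)); split.
- by apply: subN => //; apply: subZ.
- exact: subZ.
- by rewrite scalerDr scalerA mulVf // scale1r addrA addNr add0r.
Qed.

(* Vanishing of the degree n homology of the mapping cone of q. *)
Definition cone_exact (L g : dgLie) (q : dgLieHom L g) (n : int) : Prop :=
  forall x y, hcomp (n - 1) x -> hcomp n y -> diff x = 0 -> q x = diff y ->
  exists m y', [/\ hcomp n m, hcomp (n + 1) y', x = diff m & y = q m + diff y'].

(* W is a complement of the boundaries B in the cycles Z, in degree N of the cone. *)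
Lemma cone_generators (L g : dgLie) (q : dgLieHom L g) (N : int) :
  exists (W : lmodType rat) (a : {linear W -> L}) (b : {linear W -> g}),
  [/\ forall v, [/\ hcomp (N - 1) (a v), hcomp N (b v), diff (a v) = 0
        & q (a v) = diff (b v)],
      forall x y, hcomp (N - 1) x -> hcomp N y -> diff x = 0 -> q x = diff y ->
        exists v m y', [/\ hcomp N m, hcomp (N + 1) y', x = a v + diff m
          & y = b v + (q m + diff y')]
    & forall v m y', hcomp N m -> hcomp (N + 1) y' -> a v = diff m ->
        b v = q m + diff y' -> v = 0].
Proof.
pose P : lmodType rat := (L * g)%type.
(* [Z] and [B] are the cycles and boundaries of the mapping cone, up to the sign of the first
   component. *)
pose Z : set P := [set p | [/\ hcomp (N - 1) p.1, hcomp N p.2, diff p.1 = 0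
  & q p.1 = diff p.2]].
pose B : set P := [set p | exists m y', [/\ hcomp N m, hcomp (N + 1) y',
  p.1 = diff m & p.2 = q m + diff y']].
have hZ : subspace Z.
  split; first by split; rewrite ?linear0 //; apply: hcomp0.
  move=> a x y [hx1 hx2 dx ex] [hy1 hy2 dy ey]; split=> /=.
  - by apply: subP => //; apply: hcomp_sub.
  - by apply: subP => //; apply: hcomp_sub.
  - by rewrite linearP dx dy scaler0 addr0.
  - by rewrite !linearP ex ey.
have hB : subspace B.
  split; first by exists 0, 0; rewrite !linear0 addr0; split=> //; apply: hcomp0.
  move=> a x y [m [y1 [hm hy1 e1 e2]]] [m' [y1' [hm' hy1' e1' e2']]].
  exists (a *: m + m'), (a *: y1 + y1'); split=> /=.
  - by apply: subP => //; apply: hcomp_sub.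
  - by apply: subP => //; apply: hcomp_sub.
  - by rewrite linearP e1 e1'.
  - by rewrite !linearP e2 e2' scalerDr addrACA.
have BZ : B `<=` Z.
  move=> x [m [y [hm hy e1 e2]]]; split; rewrite ?e1 ?e2.
  - exact: diff_comp.
  - apply: subD; [exact: hcomp_sub|exact: grLieHom_comp|].
    by rewrite -[N](addrK 1); apply: diff_comp.
  - exact: diffK.
  - by rewrite linearD diffK addr0 dgLieHom_diff.
have [W [hW WZ WB WBZ]] := complement hB hZ BZ.
have [V [i [inji ri]]] := subspace_lmod hW.
have la : linear (fun v => (i v).1) by move=> k x y; rewrite linearP.
have lb : linear (fun v => (i v).2) by move=> k x y; rewrite linearP.
have [a aE] := mk_linear la; have [b bE] := mk_linear lb.
have Wi v : W (i v) by rewrite -ri; exists v.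
exists V, a, b; split.
- by move=> v; rewrite !aE !bE; apply: (WZ _ (Wi v)).
- move=> x y hx hy dx e.
  have /WBZ [w [[m1 m2] [Ww [m [y' /= [hm hy' e1 e2]]] exy]]] : Z (x, y) by split.
  move: Ww; rewrite -ri => -[v _ vw]; exists v, m, y'; split=> //.
    by rewrite aE vw -e1; case: (w) exy => ? ? [].
  by rewrite bE vw -e2; case: (w) exy => ? ? [].
- move=> v m y' hm hy' e1 e2; apply: inji; rewrite linear0.
  by apply: WB; split=> //; exists m, y'; rewrite -aE -bE.
Qed.

(* [gs_min] is what yields minimality: the differentials of the next generators,
   which have degree n + 2, do not involve the generators U of degree n + 1. *)
Record good_step (n : nat) (Q Q' : quasiFree) (g : dgLie) (q : dgLieHom Q g)
    (q' : dgLieHom Q' g) (j : dgLieHom Q Q') (U : set Q') : Prop := GoodStep {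
  gs_KS : KS_extension j U;
  gs_j : forall x, q' (j x) = q x;
  gs_hcomp : forall u, U u -> hcomp n.+1 u;
  gs_retract : exists r : grLieHom Q' Q,
    (forall x, r (j x) = x) /\ forall u, U u -> r u = 0;
  gs_sc : simply_connected Q';
  gs_indec : forall (X : lmodType rat) (p : {linear Q' -> X}) (k : int),
    (forall x y, p (br x y) = 0) -> k != n.+1 ->
    (forall x, hcomp k x -> p (j x) = 0) -> forall x, hcomp k x -> p x = 0;
  gs_diff : forall u, U u -> exists x y, [/\ diff u = j x, hcomp n x, diff x = 0,
    hcomp n.+1 y & q x = diff y];
  gs_min : forall x y, hcomp n.+1 x -> diff x = 0 -> hcomp n.+2 y ->
    q' x = diff y -> exists2 x0, hcomp n.+1 x0 & x = j x0;
  gs_cone : forall i : int, i <= n.+1 -> cone_exact q' i }.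

(** Surjectivity of W onto the cone homology in degree n + 1 makes the new cone exact there;
    injectivity gives [gs_min]. *)
Lemma good_step_exists (n : nat) (Q : quasiFree) (g : dgLie) (q : dgLieHom Q g) :
  simply_connected Q -> (forall i : int, i <= n -> cone_exact q i) ->
  exists (Q' : quasiFree) (q' : dgLieHom Q' g) (j : dgLieHom Q Q') (U : set Q'),
    good_step n q q' j U.
Proof.
move=> hQ hq.
have [W [a [b [hab surj inj]]]] := cone_generators q n.+1.
have n1 : n.+1%:Z - 1 = n by rewrite intS addrAC subrr add0r.
have n2 : n.+1%:Z + 1 = n.+2 by rewrite addrC -intS.
rewrite n1 in hab surj; rewrite n2 in surj inj.
have [|//|||||Q' [j [w [q' h]]]] := @attach Q g q n.+1 W a b.
- by [].
- by move=> v; have [] := hab v; rewrite n1.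
- by move=> v; have [] := hab v.
- by move=> v; have [] := hab v.
- by move=> v; have [] := hab v.
exists Q', q', j, (range w).
have [r [rj rw]] := att_retract h.
have injj x y : j x = j y -> x = y by move=> e; rewrite -[x]rj -[y]rj e.
split.
- exact: att_KS h.
- exact: att_j h.
- by move=> _ [v _ <-]; apply: att_hcomp h v.
- by exists r; split=> // _ [v _ <-].
- exact: att_sc h.
- by move=> X p k; apply: (att_indec h).
- move=> _ [v _ <-]; exists (a v), (b v); have [? ? ? ?] := hab v.
  by split=> //; apply: att_diff h v.
- move=> x y hx dx hy e.
  (* Write x as j x1 + w v. That x is a cycle and that its image bounds say that (a v, b v) is the
     boundary of (- x1, y) in the old cone, so v = 0. *)
  have [x1 [v [hx1 ex _]]] := att_low h (lexx _) hx.
  have e1 : a v = diff (- x1).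
    apply: injj; rewrite -(att_diff h) !linearN; apply/eqP.
    by rewrite -addr_eq0 addrC dgLieHom_diff -linearD -ex dx.
  have e2 : b v = q (- x1) + diff y.
    by rewrite -e ex linearD linearN (att_j h) (att_w h) addKr.
  exists x1 => //; rewrite ex (inj v (- x1) y) ?linear0 ?addr0 //.
  by apply: subN => //; apply: hcomp_sub.
(* In degree n + 1 the first entry has degree n and so comes from [Q]; the class of the pair is that
   of some u in W, which [w u] now bounds. *)
move=> i; rewrite le_eqVlt => /orP[/eqP -> x' y|].
  rewrite n1 n2 => hx' hy dx' e.
  have nn : (n : int) < n.+1 by rewrite ltz_nat.
  have [x [v [hx ex' v0]]] := att_low h (ltW nn) hx'.
  rewrite ex' v0 // linear0 addr0 in dx' e *.
  have dx : diff x = 0 by apply: injj; rewrite dgLieHom_diff dx' linear0.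
  rewrite (att_j h) in e.
  have [u [m [y' [hm hy' e1 e2]]]] := surj x y hx hy dx e.
  exists (w u + j m), y'; split=> //.
  - apply: subD; [exact: hcomp_sub|exact: att_hcomp h u|exact: grLieHom_comp].
  - by rewrite linearD (att_diff h) -dgLieHom_diff -linearD -e1.
  - by rewrite linearD (att_w h) (att_j h) -addrA.
(* In lower degrees the pair already lives over [Q], where the cone is exact. *)
move=> iN x' y hx' hy dx' e.
have iN' : i - 1 < n.+1%:Z by rewrite (lt_trans _ iN) // ltrBlDr ltrDl.
have [x [v [hx ex' v0]]] := att_low h (ltW iN') hx'.
rewrite ex' v0 // linear0 addr0 in dx' e *.
have dx : diff x = 0 by apply: injj; rewrite dgLieHom_diff dx' linear0.
rewrite (att_j h) in e.
have [|m [y' [hm hy' e1 e2]]] := hq i _ x y hx hy dx e.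
  by rewrite -ltzD1 addrC -intS.
exists (j m), y'; split=> //.
- exact: grLieHom_comp.
- by rewrite -dgLieHom_diff -e1.
- by rewrite (att_j h).
Qed.

(** * Sequential colimits *)

Section Colimit.
Variables (M : nat -> quasiFree) (j : forall n, dgLieHom (M n) (M n.+1)).

Definition colE (n : nat) : gradedSpace := M n.

(** The relations make each stage map by a morphism and identify elements along the transition maps,
    again stated on homogeneous elements. *)
Inductive col_rel : term colE -> term colE -> Prop :=
| ColBr n i k (x y : M n) : hcomp i x -> hcomp k y ->
    col_rel (tgen (E := colE) (i := n) (br x y))
      (tbr (tgen (E := colE) (i := n) x) (tgen (E := colE) (i := n) y))
| ColTrans n i (x : M n) : hcomp i x ->
    col_rel (tgen (E := colE) (i := n.+1) (j n x)) (tgen (E := colE) (i := n) x).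

Lemma col_homR s t : col_rel s t -> exists n, hdeg n s /\ hdeg n t.
Proof.
case=> [n i k x y hx hy|n i x hx].
  exists (i + k); split; first by apply: hdeg_gen; apply: br_comp.
  by apply: hdeg_br; apply: hdeg_gen.
by exists i; split; apply: hdeg_gen => //; apply: grLieHom_comp.
Qed.

Lemma col_presentation :
  exists C gen, @presents _ colE col_rel id (fun n => @diff (M n)) C gen.
Proof.
apply: (presentation (homR := col_homR)).
- by move=> n; apply: linearP.
- by move=> n k x; apply: diff_comp.
- by move=> n x; apply: diffK.
move=> s t [n i k x y hx hy|n i x hx].
  have hX : hcomp (g := presLie col_homR) i (pgen col_rel (i := n) x).
    exact: (@pgen_comp _ colE col_rel n i x hx).
  have relE m' n' (x' y' : M n) : hcomp m' x' -> hcomp n' y' ->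
      pgen col_rel (i := n) (br x' y') =
      br (pgen col_rel (i := n) x' : presLie col_homR) (pgen col_rel (i := n) y').
    move=> hx' hy'; apply: etrans (pcls_eq (eqv_rel (ColBr hx' hy'))) _.
    exact: pclsB.
  rewrite derB !derG /genD /= (diff_br y hx) addrC pgen_lin addrC.
  rewrite (relE _ _ _ _ (diff_comp hx) hy) (relE _ _ _ _ hx (diff_comp hy)).
  by rewrite (sigmaE hX) linearZl_LR.
rewrite !derG /genD /= -dgLieHom_diff.
exact: (pcls_eq (eqv_rel (ColTrans (diff_comp hx)))).
Qed.

Lemma leg_lift (C : dgLie) (leg : forall n, dgLieHom (M n) C) :
  (forall n x, leg n.+1 (j n x) = leg n x) ->
  forall i n (x : M n), hcomp i x -> forall m, (n <= m)%N ->
  exists x' : M m, hcomp i x' /\ leg m x' = leg n x.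
Proof.
move=> legj i n x hx; elim=> [|m IH].
  by rewrite leqn0 => /eqP n0; subst n; exists x.
rewrite leq_eqVlt => /orP[/eqP nm|]; first by subst n; exists x.
move=> /IH [x' [hx' <-]]; exists (j m x'); split; last exact: legj.
exact: grLieHom_comp.
Qed.

(** The universal property is also established among graded Lie algebras, for cocones that ignore
    differentials. Homogeneous elements come from a single stage, since two stages can be compared
    in the later one. *)
Lemma colimit : exists (C : dgLie) (leg : forall n, dgLieHom (M n) C),
  [/\ is_colimit j leg,
      forall (L : grLie) (c : forall n, grLieHom (M n) L),
        (forall n x, c n.+1 (j n x) = c n x) ->
        exists F : grLieHom C L, forall n x, F (leg n x) = c n x,
      forall (L : grLie) (F G : grLieHom C L),
        (forall n x, F (leg n x) = G (leg n x)) -> forall x, F x = G x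
    & forall i x, hcomp i x -> exists n (y : M n), hcomp i y /\ x = leg n y].
Proof.
have [C [gen pC]] := col_presentation.
have leg_ex n : {l : dgLieHom (M n) C | forall x, l x = gen n x}.
  have genE i k (x y : M n) : hcomp i x -> hcomp k y ->
      gen n (br x y) = br (gen n x) (gen n y).
    by move=> hx hy; apply: (gen_rel pC (ColBr hx hy)).
  have [l lE] :=
    mk_grLieHom (L := M n) (gen_lin pC (i := n)) (gen_hcomp pC (i := n)) genE.
  have ld x : l (diff x) = diff (l x) by rewrite !lE (gen_diff pC).
  by exists (DGLieHom ld).
pose leg n := sval (leg_ex n).
have legE n x : leg n x = gen n x := svalP (leg_ex n) x.
have legj n x : leg n.+1 (j n x) = leg n x.
  move: x; apply: homog_ind => [x y hx hy|i x hx]; first by rewrite !linearD hx hy.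
  by rewrite !legE; apply: (gen_rel pC (ColTrans hx)).
have univ (L : grLie) (c : forall n, grLieHom (M n) L) :
    (forall n x, c n.+1 (j n x) = c n x) ->
    exists F : grLieHom C L, forall n x, F (leg n x) = c n x.
  move=> hc; have [|||F hF] := gen_hom pC (v := fun n => c n : colE n -> L).
  - by move=> n; apply: linearP.
  - by move=> n i x; apply: grLieHom_comp.
  - by move=> s t [n i k x y hx hy|n i x hx] /=; rewrite ?grLieHom_br.
  by exists F => n x; rewrite legE hF.
have uniq (L : grLie) (F G : grLieHom C L) :
    (forall n x, F (leg n x) = G (leg n x)) -> forall x, F x = G x.
  by move=> h; apply: (gen_uniq pC) => n x; rewrite -legE.
exists C, leg; split=> //.
- split=> // D c hc; have [F hF] := univ D c hc.
  have Fd x : F (diff x) = diff (F x).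
    move: x; apply: (gen_dghom pC) => n x.
    by rewrite -!legE !hF dgLieHom_diff.
  by exists (DGLieHom Fd); split=> // G hG; apply: uniq => n x; rewrite hG hF.
have lift := leg_lift legj.
move=> i x; move: i x; apply: (gen_ind pC).
- by move=> n i x hx; exists n, x; rewrite legE.
- by move=> i; exists 0%N, 0; rewrite linear0; split=> //; apply: hcomp0.
- move=> i a _ _ _ _ [n [x [hx ->]]] [m [y [hy ->]]].
  have [x' [hx' <-]] := lift _ _ _ hx _ (leq_maxl n m).
  have [y' [hy' <-]] := lift _ _ _ hy _ (leq_maxr n m).
  exists (maxn n m), (a *: x' + y'); rewrite linearP; split=> //.
  by apply: subP => //; apply: hcomp_sub.
- move=> i k _ _ _ _ [n [x [hx ->]]] [m [y [hy ->]]].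
  have [x' [hx' <-]] := lift _ _ _ hx _ (leq_maxl n m).
  have [y' [hy' <-]] := lift _ _ _ hy _ (leq_maxr n m).
  exists (maxn n m), (br x' y'); rewrite grLieHom_br; split=> //.
  exact: br_comp.
Qed.

End Colimit.

(* The retractions are not compatible with differentials, so this cocone only
   exists in graded Lie algebras; it detects that the legs are injective. *)
Lemma cocone_from (M : nat -> grLie) (j : forall n, grLieHom (M n) (M n.+1))
    (r : forall n, grLieHom (M n.+1) (M n)) (L : grLie) (n : nat) (h : grLieHom (M n) L) :
  (forall n x, r n (j n x) = x) ->
  exists c : forall m, grLieHom (M m) L,
  [/\ forall m x, c m.+1 (j m x) = c m x, forall x, c n x = h x
    & forall m x, (n <= m)%N -> c m.+1 x = c m (r m x)].
Proof.
elim: n M j r h => [|n IH] M j r h rj.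
  pose c := fix c m : grLieHom (M m) L :=
    match m with 0%N => h | m.+1 => sval (grLieHom_compose (c m) (r m)) end.
  have cS m x : c m.+1 x = c m (r m x) := svalP (grLieHom_compose (c m) (r m)) x.
  by exists c; split=> // m x; rewrite cS rj.
(* For n + 1 the sequence is shifted by one, and the missing map at stage 0 is obtained through
   [j 0]. *)
have [c [cj ch cr]] := IH (fun n => M n.+1) (fun n => j n.+1) (fun n => r n.+1) h
  (fun n => rj n.+1).
pose c' m : grLieHom (M m) L :=
  match m with 0%N => sval (grLieHom_compose (c 0%N) (j 0%N)) | m.+1 => c m end.
exists c'; split=> //.
  by case=> [|m] x /=; rewrite ?cj //; case: grLieHom_compose.
by case=> [|m] x // nm; apply: cr.
Qed.

(** * From exactness of the cone to quasi-isomorphisms *)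

(** If q z' - q z = d y, exactness in degree n + 1 at (z' - z, y) makes z' - z a boundary, which is
    injectivity on H_n; exactness in degree n at (0, z) gives surjectivity. *)
Lemma cone_exact_quasi_iso (L g : dgLie) (q : dgLieHom L g) :
  (forall n, cone_exact q n) -> quasi_iso q.
Proof.
move=> hq n.
have bsub (D : dgLie) : subspace (@boundaries D n).
  by apply: subspace_image; apply: hcomp_sub.
have cosetE (D : dgLie) (z z' : D) :
    coset (boundaries n) z = coset (boundaries n) z' <-> boundaries n (z' - z).
  split=> [e|h].
    have : coset (boundaries n) z' z' by rewrite /coset /= subrr; apply: sub0.
    by rewrite -e.
  apply/seteqP; split=> y; rewrite /coset /= => hy.
    have -> : y - z' = (y - z) - (z' - z) by rewrite opprB addrA subrK.
    exact: subB.
  have -> : y - z = (y - z') + (z' - z) by rewrite addrA subrK.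
  exact: subD.
have qB (x : L) : boundaries n x -> boundaries n (q x).
  by move=> [y hy <-]; exists (q y); [apply: grLieHom_comp|rewrite dgLieHom_diff].
have mapE z : homology_map q n (coset (boundaries n) z) = coset (boundaries n) (q z).
  apply/seteqP; rewrite /coset; split=> [y [x /= xz yx]|y /= yz] /=.
    have -> : q z = q x - q (x - z) by rewrite linearB opprB addrC subrK.
    by rewrite opprB addrCA addrC; apply: subD => //; apply: qB.
  by exists z => //; rewrite /= subrr; apply: sub0.
split.
- move=> _ [z [dz hz] <-]; rewrite mapE; exists (q z) => //.
  by split; [rewrite /cycles /= -dgLieHom_diff dz linear0|apply: grLieHom_comp].
- move=> c c' /set_mem [z [dz hz] <-] /set_mem [z' [dz' hz'] <-].
  rewrite !mapE => /cosetE [y hy ey]; apply/cosetE.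
  have [||||m [y' [hm _ em _]]] := hq (n + 1) (z' - z) y.
  - by rewrite addrK; apply: subB => //; apply: hcomp_sub.
  - exact: hy.
  - by rewrite linearB dz dz' subrr.
  - by rewrite linearB ey.
  by exists m.
- move=> _ [z [dz hz] <-].
  have [||||m [y [hm hy em ez]]] := hq n 0 z.
  - exact: hcomp0.
  - exact: hz.
  - exact: linear0.
  - by rewrite linear0.
  exists (coset (boundaries n) m); first by exists m.
  by rewrite mapE; apply/cosetE; exists y => //; rewrite ez addrC addKr.
Qed.

(** * The minimal relative model *)

(** The nth stage bundled with the invariant that allows the construction to continue. *)
Record state (g : dgLie) (n : nat) := State {
  st_Q : quasiFree;
  st_q : dgLieHom st_Q g;
  st_sc : simply_connected st_Q;
  st_cone : forall i : int, i <= n -> cone_exact st_q i }.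

(** Existence is turned into data by choice, so that stages can be defined by recursion. *)
Lemma next_state (g : dgLie) (n : nat) (s : state g n) :
  {s' : state g n.+1 & {j : dgLieHom (st_Q s) (st_Q s') &
    {U : set (st_Q s') | good_step n (st_q s) (st_q s') j U}}}.
Proof.
have [Q' /cid [q' /cid [j /cid [U h]]]] :=
  cid (good_step_exists (@st_sc _ _ s) (@st_cone _ _ s)).
by exists (State (gs_sc h) (gs_cone h)), j, U.
Qed.

Lemma good_sequence (Q : quasiFree) (g : dgLie) (f : dgLieHom Q g) :
  simply_connected Q -> simply_connected g ->
  exists (nx : nat -> quasiFree)
    (j : forall n, dgLieHom (stages Q nx n) (stages Q nx n.+1))
    (U : forall n, set (stages Q nx n.+1)) (q : forall n, dgLieHom (stages Q nx n) g),
    q 0%N = f /\ forall n, good_step n (q n) (q n.+1) (j n) (U n).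
Proof.
move=> hQ hg.
(* The cone in degree i pairs degree i - 1 of [Q] with degree i of [g]; both vanish for i at most
   0. *)
have c0 (i : int) : i <= 0%N -> cone_exact f i.
  move=> i0 x y hx hy _ _; exists 0, 0; rewrite !linear0 addr0.
  have i1 : i < 1 := le_lt_trans i0 ltr01.
  split; try exact: hcomp0.
    have : [set 0] x by rewrite -(hQ (i - 1)) // (lt_trans _ i1) // ltrBlDr ltrDl.
    by [].
  by have : [set 0] y by rewrite -(hg i).
pose S := fix S n : state g n :=
  match n with 0%N => State hQ c0 | n.+1 => projT1 (next_state (S n)) end.
pose nx n := st_Q (S n.+1).
(* The two branches read alike; the case split is there because [stages] computes only on a
   constructor. *)
pose j n : dgLieHom (stages Q nx n) (stages Q nx n.+1) :=
  match n with
  | 0%N => projT1 (projT2 (next_state (S 0%N)))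
  | n.+1 => projT1 (projT2 (next_state (S n.+1)))
  end.
pose U n : set (stages Q nx n.+1) :=
  match n with
  | 0%N => sval (projT2 (projT2 (next_state (S 0%N))))
  | n.+1 => sval (projT2 (projT2 (next_state (S n.+1))))
  end.
pose q n : dgLieHom (stages Q nx n) g :=
  match n with 0%N => f | n.+1 => st_q (S n.+1) end.
exists nx, j, U, q; split=> // -[|n].
  exact: svalP (projT2 (projT2 (next_state (S 0%N)))).
exact: svalP (projT2 (projT2 (next_state (S n.+1)))).
Qed.

(** * Abelian graded Lie algebras *)

Section Abelian.
Variable G : gradedSpace.

Definition ab_br : {bilinear G -> G -> G}.
Proof.
apply: (sval (@mk_bilinear G G G (fun _ _ => 0) _ _)) => u a x y;
  by rewrite scaler0 addr0.
Defined.

Lemma ab_brE x y : ab_br x y = 0.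
Proof. by rewrite /ab_br; case: mk_bilinear => b /= ->. Qed.

Lemma ab_comp i j (x y : G) : hcomp i x -> hcomp j y -> hcomp (i + j) (ab_br x y).
Proof. by rewrite ab_brE => _ _; apply: hcomp0. Qed.
Lemma ab_antisym i j (x y : G) : hcomp i x -> hcomp j y ->
  ab_br x y = - ((-1) ^ (i * j) *: ab_br y x).
Proof. by rewrite !ab_brE scaler0 oppr0. Qed.
Lemma ab_jacobi i j (x y z : G) : hcomp i x -> hcomp j y ->
  ab_br x (ab_br y z) = ab_br (ab_br x y) z + (-1) ^ (i * j) *: ab_br y (ab_br x z).
Proof. by rewrite !ab_brE scaler0 addr0. Qed.

(** Morphisms into it are the linear maps of degree 0 that kill brackets, so freeness produces the
    projection onto W as such a morphism. *)
Definition abelian : grLie := GrLie ab_comp ab_antisym ab_jacobi.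

End Abelian.

(** * The colimit as a minimal relative model *)

Section Assemble.
Variables (Q : quasiFree) (g : dgLie) (f : dgLieHom Q g).
Hypothesis hQ : simply_connected Q.
Variable nx : nat -> quasiFree.
Notation M := (stages Q nx).
Variables (j : forall n, dgLieHom (M n) (M n.+1)) (U : forall n, set (M n.+1)).
Variable q : forall n, dgLieHom (M n) g.
Hypothesis q0 : q 0%N = f.
Hypothesis gs : forall n, good_step n (q n) (q n.+1) (j n) (@U n).

Variables (C : dgLie) (leg : forall n, dgLieHom (M n) C).
Hypothesis col : is_colimit j leg.
Hypothesis univ : forall (L : grLie) (c : forall n, grLieHom (M n) L),
  (forall n x, c n.+1 (j n x) = c n x) ->
  exists F : grLieHom C L, forall n x, F (leg n x) = c n x.
Hypothesis uniq : forall (L : grLie) (F G : grLieHom C L),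
  (forall n x, F (leg n x) = G (leg n x)) -> forall x, F x = G x.
Hypothesis ex_leg : forall i x, hcomp i x -> exists n (y : M n), hcomp i y /\ x = leg n y.

Lemma legj n x : leg n.+1 (j n x) = leg n x.
Proof. by case: col => h _; apply: h. Qed.

Definition retract n : grLieHom (M n.+1) (M n) := sval (cid (gs_retract (gs n))).

Lemma retractj n x : retract n (j n x) = x.
Proof. by case: (svalP (cid (gs_retract (gs n)))) => h _; apply: h. Qed.

Lemma retractU n u : U u -> retract n u = 0.
Proof. by case: (svalP (cid (gs_retract (gs n)))) => _ h; apply: h. Qed.

(** The cocone with vertex [M n] uses the transition maps up to stage n and the retractions beyond
    it, which kill the later generators. *)
Lemma leg_section n : exists F : grLieHom C (M n), (forall x, F (leg n x) = x) /\
  forall m u, (n <= m)%N -> U u -> F (leg m.+1 u) = 0.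
Proof.
have [h hE] := grLieHom_id (M n).
have [c [cj ch cr]] := @cocone_from (fun n => M n) (fun n => j n) retract _ n h retractj.
have [F hF] := univ cj; exists F; split=> [x|m u nm hu]; first by rewrite hF ch.
by rewrite hF cr // retractU // linear0.
Qed.

Lemma leg_inj n : injective (leg n).
Proof. by have [F [hF _]] := leg_section n; move=> x y e; rewrite -[x]hF e hF. Qed.

Definition newW n : set C := leg n.+1 @` @U n.
Definition W : set C := dspan newW.
Definition V : set C := leg 0%N @` gens Q.

Lemma U_sub n : subspace (@U n).
Proof. by have [_ /graded_subspaceP[]] := gs_KS (gs n). Qed.

Lemma newW_sub n : subspace (newW n).
Proof. by apply: subspace_image; apply: U_sub. Qed.

Lemma newW_hcomp n x : newW n x -> hcomp n.+1 x.
Proof. by move=> [u hu <-]; apply: grLieHom_comp; apply: gs_hcomp (gs n) _ hu. Qed.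

(** The nth summand lies in degree n + 1, so independence is inherited from the homogeneous
    components. *)
Lemma W_direct : is_direct_sum W newW.
Proof.
split; [exact: newW_sub|by []|move=> s c us hc e0 i si].
(* The family [c] reindexed by degree, with 0 in degrees at most 0. *)
pose c' (k : int) : C := if k is Posz n.+1 then c n else 0.
case: (comp_direct C) => _ _ h.
apply: (h [seq Posz i.+1 | i <- s] c' _ _ _ (Posz i.+1)).
- by rewrite map_inj_uniq // => m n [].
- case=> [[|n]|n]; try exact: hcomp0.
  exact: newW_hcomp.
- by rewrite big_map.
- by apply/mapP; exists i.
Qed.

Lemma W_sub : subspace W. Proof. by apply: dspan_sub; apply: newW_sub. Qed.

Lemma comp_linear_map n : linear (@hpart C n).
Proof. by move=> a x y; apply: comp_lin. Qed.

Lemma W_graded : graded_subspace W.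
Proof.
apply/graded_subspaceP; split=> [|n x [s [c [hc ->]]]]; first exact: W_sub.
have [F FE] := mk_linear (comp_linear_map n).
rewrite -FE linear_sum; apply: sub_sum => [|i _]; first exact: W_sub.
rewrite FE (comp_hcomp n (newW_hcomp (hc i))); case: eqP => _; last exact: (sub0 W_sub).
exact: (dspan_gen newW_sub (hc i)).
Qed.

Lemma V_graded : graded_subspace V.
Proof.
apply: graded_image; first by move=> n x; apply: grLieHom_comp.
by case: (gens_free Q).
Qed.

Lemma V_sub : subspace V. Proof. by have /graded_subspaceP[] := V_graded. Qed.

(** The section at stage 0 is the identity on V and kills W. *)
Lemma VW_disjoint : V `&` W = [set 0].
Proof.
apply/seteqP; split=> x /=; last first.
  by move=> ->; split; [exact: (sub0 V_sub)|exact: (sub0 W_sub)].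
move=> [[v hv <-] [s [c [hc e]]]].
have [F [Fl FU]] := leg_section 0%N.
suff -> : v = 0 by rewrite linear0.
rewrite -(Fl v) e linear_sum big1 // => i _.
by have [u hu <-] := hc i; apply: FU.
Qed.

Lemma leg_gens n x : gens (M n) x -> sumset V W (leg n x).
Proof.
have VW : subspace (sumset V W) := subspace_sumset V_sub W_sub.
elim: n x => [|n IH] x hx.
  by exists (leg 0%N x), 0; rewrite addr0; split; [exists x|exact: (sub0 W_sub)|].
have [_ _ gE _ _] := gs_KS (gs n).
have : sumset (j n @` gens (M n)) (@U n) x by rewrite -gE.
move=> [_ [u [[y hy <-] hu ->]]]; rewrite linearD legj; apply: subD => //.
  exact: IH.
exists 0, (leg n.+1 u); rewrite add0r; split=> //; first exact: (sub0 V_sub).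
by apply: (dspan_gen newW_sub (i := n)); exists u.
Qed.

(** The map [phi], pulled back along the legs, extends to each free stage; uniqueness of these
    extensions makes them a cocone, which the colimit glues. *)
Lemma VW_free : free_on (sumset V W).
Proof.
split; first by apply: graded_sumset; [apply: V_graded|apply: W_graded].
move=> L phi [lphi hphi].
have Fex n : {F : grLieHom (M n) L | (forall v, gens (M n) v -> F v = phi (leg n v)) /\
    forall G : grLieHom (M n) L, (forall v, gens (M n) v -> G v = phi (leg n v)) ->
      forall x, G x = F x}.
  apply: cid; have [_ h] := gens_free (M n); apply: (h L (fun v => phi (leg n v))).
  split=> [a x y hx hy|k x hx hk]; first by rewrite linearP lphi //; apply: leg_gens.
  by apply: hphi; [apply: leg_gens|apply: grLieHom_comp].
pose c n := sval (Fex n).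
have cE n v : gens (M n) v -> c n v = phi (leg n v) := (svalP (Fex n)).1 v.
have cU n := (svalP (Fex n)).2 : forall G : grLieHom (M n) L, _ -> forall x, G x = c n x.
have cj n x : c n.+1 (j n x) = c n x.
  have [G hG] := grLieHom_compose (c n.+1) (j n).
  rewrite -hG; apply: cU => v hv; rewrite hG cE ?legj //.
  have [_ /graded_subspaceP[sU _] -> _ _] := gs_KS (gs n).
  by exists (j n v), 0; rewrite addr0; split; [exists v|exact: sub0|].
have [F hF] := univ cj.
have phiV v : gens Q v -> F (leg 0%N v) = phi (leg 0%N v).
  by move=> hv; rewrite hF cE.
exists F; split=> [x hx|G hG]; last first.
  apply: uniq => n x; rewrite hF.
  have [G' hG'] := grLieHom_compose G (leg n).
  by rewrite -hG'; apply: cU => v hv; rewrite hG' hG //; apply: leg_gens.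
have VW : subspace (sumset V W) := subspace_sumset V_sub W_sub.
have inV v : V v -> sumset V W v.
  by move=> hv; exists v, 0; rewrite addr0; split=> //; exact: (sub0 W_sub).
have inW w : W w -> sumset V W w.
  by move=> hw; exists 0, w; rewrite add0r; split=> //; exact: (sub0 V_sub).
have phiD a b : sumset V W a -> sumset V W b -> phi (a + b) = phi a + phi b.
  by move=> ? ?; rewrite -[a in LHS]scale1r lphi // scale1r.
have phi0 : phi 0 = 0.
  have := phiD 0 0 (sub0 VW) (sub0 VW); rewrite addr0 => /eqP.
  by rewrite -subr_eq0 opprD addrA subrr add0r oppr_eq0 => /eqP.
case: hx => [_ [_ [[v hv <-] [s [c' [hc' ->]]] ->]]].
have Wc i : W (c' i) := dspan_gen newW_sub (hc' i).
rewrite linearD phiD; [|by apply: inV; exists v|by apply: inW; exists s, c'].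
(* As [phi] is linear on V + W only, the sum is split one term at a time, with membership checked at
   each step. *)
rewrite phiV //; congr (_ + _); elim: s => [|i s IH]; first by rewrite !big_nil linear0.
rewrite !big_cons linearD IH phiD; [|exact: inW|by apply: inW; exists s, c'].
congr (_ + _); have [u hu <-] := hc' i; rewrite hF cE //.
have [_ _ -> _ _] := gs_KS (gs i).
exists 0, u; rewrite add0r; split=> //.
have /graded_subspaceP [sV _] : graded_subspace (j i @` gens (M i)).
  apply: graded_image => [k y|]; first exact: grLieHom_comp.
  by case: (gens_free (M i)).
exact: (sub0 sV).
Qed.

Definition model : relDGLie Q :=
  RelDGLie (fun n => gs_KS (gs n)) col W_direct VW_disjoint VW_free.

(** The projection kills everything in [M n] of degree above n, and the differentials of the new
    generators turn out to be of that kind. *)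
Lemma model_minimal : minimal model.
Proof.
have VWuniq v v' w w' : V v -> V v' -> W w -> W w' -> v + w = v' + w' -> w = w'.
  move=> hv hv' hw hw' e; apply/eqP; rewrite -subr_eq0; apply/eqP.
  suff : (V `&` W) (w - w') by rewrite VW_disjoint.
  split; last exact: subB W_sub _ _ _ _.
  have -> : w - w' = v' - v.
    by apply/eqP; rewrite subr_eq addrAC -e addrAC subrr add0r.
  exact: subB V_sub _ _ _ _.
(* The W-component of an element of V + W; the value 0 elsewhere is a mere default. *)
pose phi (x : C) : abelian C :=
  match pselect (exists w, W w /\ V (x - w)) with
  | left e => sval (cid e) | right _ => 0 end.
have phiE v w : V v -> W w -> phi (v + w) = w.
  move=> hv hw; rewrite /phi; case: pselect => [e|[]]; last first.
    by exists w; rewrite addrK.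
  case: cid => w' [hw' hv'] /=.
  by apply/esym; apply: (VWuniq _ _ _ _ hv hv' hw hw'); rewrite subrK.
have [|p [pE _]] := VW_free.2 (abelian C) phi.
  split=> [a _ _ [v [w [hv hw ->]]] [v' [w' [hv' hw' ->]]]|n _ [v [w [hv hw ->]]] hn].
    rewrite scalerDr addrACA !phiE //; apply: subP => //; [exact: V_sub|exact: W_sub].
  rewrite phiE //.
  have -> : w = hpart n w.
    have [_ cV] := (graded_subspaceP _).1 V_graded.
    have [_ cW] := (graded_subspaceP _).1 W_graded.
    apply: (VWuniq v (hpart n v)) => //; [exact: cV|exact: cW|].
    have := comp_hcomp n hn; rewrite eqxx => <-.
    by rewrite -[v in LHS]scale1r comp_lin scale1r.
  exact: compP.
have pb x y : p (br x y) = 0 by rewrite grLieHom_br; apply: ab_brE.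
have pV v : V v -> p v = 0.
  move=> hv; rewrite pE; last first.
    by exists v, 0; rewrite addr0; split=> //; exact: (sub0 W_sub).
  by rewrite -[v]addr0 phiE //; exact: (sub0 W_sub).
have pW w : W w -> p w = w.
  move=> hw; rewrite pE; last first.
    by exists 0, w; rewrite add0r; split=> //; exact: (sub0 V_sub).
  by rewrite -[w]add0r phiE ?add0r //; exact: (sub0 V_sub).
(* Generators W^i with i <= n have degree at most n. *)
have plow n (k : int) (x : M n) : (n : int) < k -> hcomp k x -> p (leg n x) = 0.
  elim: n k x => [|n IH] k x nk hx.
    (* On stage 0, [p] vanishes on the free generators, so it agrees with the zero morphism into the
       abelian algebra. *)
    have [G hG] := grLieHom_compose p (leg 0%N).
    have [|||Z hZ] := @mk_grLieHom Q (abelian C) (fun=> 0).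
    - by move=> a u v; rewrite scaler0 addr0.
    - by move=> m u _; apply: hcomp0.
    - by move=> *; rewrite linear0l.
    have [_ /(_ (abelian C) (fun=> 0)) [|F [_ FU]]] := gens_free Q.
      by split=> [a u v _ _|m u _ _]; [rewrite scaler0 addr0|apply: hcomp0].
    rewrite -hG (FU G) -?(FU Z) ?hZ // => v hv.
    by rewrite hG; apply: pV; exists v.
  have lp : linear (fun y : M n.+1 => p (leg n.+1 y)) by move=> a u v; rewrite !linearP.
  have [F FE] := mk_linear lp.
  rewrite -FE; apply: (gs_indec (gs n) _ _ _ hx).
  - by move=> u v; rewrite FE grLieHom_br.
  - by rewrite gt_eqF.
  - move=> y hy; rewrite FE legj; apply: (IH k) => //.
    by apply: lt_trans nk; rewrite ltz_nat.
exists (p : {linear C -> C}).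
  by split.
move=> w [s [c [hc ->]]]; rewrite linear_sum linear_sum big1 // => n _.
have [u hu <-] := hc n.
have [x [y [ux hx dx hy e]]] := gs_diff (gs n) hu.
rewrite -dgLieHom_diff ux legj.
(* The differential of a generator from stage n + 1 has degree n: it vanishes if n = 0, and
   otherwise [gs_min] brings it from stage n - 1, where [plow] applies. *)
case: n {hc hu ux u} x y hx dx hy e => [|n] x y hx dx hy e.
  have -> : x = 0 by have : [set 0] x by rewrite -(hQ (n := 0)).
  by rewrite !linear0.
have [x0 hx0 ->] := gs_min (gs n) hx dx hy e.
by rewrite legj; apply: (plow n n.+1) => //; rewrite ltz_nat.
Qed.

(** A cone cycle of degree i over the colimit already lives over some stage; moved to a stage of
    index at least i, it bounds there. Injectivity of the legs ensures that its lift is a cycle. *)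
Lemma model_quasi_iso : exists qC : dgLieHom model g,
  quasi_iso qC /\ forall x, f x = qC (rel_incl model x).
Proof.
have [_ /(_ g q) [n x|qC [hqC _]]] := col; first exact: gs_j (gs n) x.
exists qC; split; last by move=> x; rewrite -[rel_incl _ _]/(leg 0%N x) hqC q0.
apply: cone_exact_quasi_iso => i x y hx hy dx e.
have [n [x1 [hx1 ex1]]] := ex_leg hx.
have [x2 [hx2 ex2]] := leg_lift legj hx1 (leq_trans (leq_maxl n `|i|%N) (leqnSn _)).
(* The index is a successor because [gs_cone] speaks of the target of a step. *)
set m := (maxn n `|i|%N).+1 in x2 hx2 ex2.
have ex : x = leg m x2 by rewrite ex1 ex2.
have dx2 : diff x2 = 0.
  by apply: (@leg_inj m); rewrite linear0 dgLieHom_diff -ex.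
have im : i <= m.
  rewrite (le_trans (ler_norm i)) // -abszE lez_nat.
  exact: leq_trans (leq_maxr _ _) (leqnSn _).
have [|z [y' [hz hy' e1 e2]]] := gs_cone (gs _) im hx2 hy dx2.
  by rewrite -hqC -ex.
exists (leg m z), y'; split=> //.
- exact: grLieHom_comp.
- by rewrite ex e1 dgLieHom_diff.
- by rewrite hqC.
Qed.

End Assemble.

Theorem theorem3p7 (LV : quasiFree) (g : dgLie) (f : dgLieHom LV g)
    (hLV : simply_connected LV) (hg : simply_connected g) :
  exists (M : relDGLie LV) (q : dgLieHom M g),
    [/\ minimal M, quasi_iso q & forall x : LV, f x = q (rel_incl M x)].
Proof.
have [nx [j [U [q [q0 gs]]]]] := good_sequence f hLV hg.
have [C [leg [col univ uniq ex_leg]]] := colimit j.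
have [qC [hq hf]] := model_quasi_iso q0 gs col univ uniq ex_leg.
exists (model gs col univ uniq), qC; split=> //.
exact: model_minimal.
Qed.
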